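(* Fix $\beta>0$ and a standard Brownian motion $B$. There exists an event of probability one on which the following holds. For all $a\in\mathbb{R}$ and all $(t_0,x_0)\in\mathbb{R}_+\times(\mathbb{R}\cup\{+\infty\})$, the forward diffusion $Z_a^{(t_0,x_0)}(t)$ converges to either $+\infty$ or $-\infty$ as $t\to\infty$. Moreover, for all $a\in\mathbb{R}$ there exists a unique path $\hat Z_a=\hat Z_a^{(+\infty,-\infty)}$ solving $$d\hat Z_a(t) = \Big(a+\frac\beta4 t-\hat Z_a(t)^2\Big)dt + dB(t),\quad t\in[0,\infty),\qquad \hat Z_a(+\infty)=-\infty.$$
   Context: For $a\in\mathbb{R}$ and $(t_0,x_0)\in\mathbb{R}_+\times(-\infty,+\infty]$, the forward diffusion $Z_a^{(t_0,x_0)}$ is the solution on $[t_0,\infty)$ of $dZ(t)=(a+\frac\beta4 t-Z(t)^2)dt+dB(t)$, $Z(t_0)=x_0$ (it comes down from $+\infty$ if $x_0=+\infty$); whenever it hits $-\infty$ in finite time it is restarted immediately from $+\infty$. A path is a function from an interval of $\mathbb{R}$ into $\mathbb{R}\cup\{\pm\infty\}$; a path solving the equation above backward in time, when it hits $+\infty$ (as time decreases), is restarted from $-\infty$. All these objects are solutions of ODEs driven pathwise by the continuous trajectory of $B$. *)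

(* Defs.v *)
From HB Require Import structures.
From mathcomp Require Import all_boot all_order all_algebra.
From mathcomp Require Import all_classical all_reals all_analysis.
Set Implicit Arguments. Unset Strict Implicit. Unset Printing Implicit Defensive.
Import Order.TTheory GRing.Theory Num.Theory.
Import numFieldNormedType.Exports.
Local Open Scope classical_set_scope.
Local Open Scope ring_scope.

(* Standard Brownian motion on [0,+oo) defined on the probability space P,
   given by its finite-dimensional distributions: B_0 = 0, continuous paths
   on [0,+oo), and for 0 <= t_0 < t_1 < ... < t_n the increments
   B_{t_{i+1}} - B_{t_i} are independent N(0, t_{i+1} - t_i)
   (normal_prob takes mean and standard deviation). *)
Definition is_std_brownian {R : realType} {d : measure_display}
  {T : measurableType d} (P : probability T R) (B : T -> R -> R) : Prop :=
  [/\ forall w, B w 0 = 0,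
      forall w, {within `[0, +oo[, continuous (B w)},
      forall t, 0 <= t -> measurable_fun setT (fun w => B w t)
    & forall (n : nat) (ts : nat -> R) (A : nat -> set R),
        0 <= ts 0%N ->
        (forall i, (i < n)%N -> ts i < ts i.+1) ->
        (forall i, (i < n)%N -> measurable (A i)) ->
        P (\bigcap_(i in `I_n) [set w | A i (B w (ts i.+1) - B w (ts i))])
        = (\prod_(i < n) normal_prob 0 (Num.sqrt (ts i.+1 - ts i)) (A i))%E].

(* Pathwise solution, driven by the continuous path b, of
     dZ = (a + beta/4 t - Z^2) dt + db(t)
   forward in time on [t0, +oo) from Z(t0) = x0 (x0 = +oo: comes down from
   +oo), where hitting -oo at time tau means restarting from +oo:
   convention Z(tau) = +oo, Z -> -oo as t -> tau^- and Z -> +oo as t -> tau^+.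
   Where Z is finite, Z - b is differentiable with the ODE's derivative. *)
Definition forward_sol {R : realType} (b : R -> R) (beta a t0 : R)
  (x0 : \bar R) (Z : R -> \bar R) : Prop :=
  [/\ Z t0 = x0,
      Z s @[s --> t0^'+] --> x0,
      forall t, t0 <= t -> Z t != -oo%E,
      forall t (r : R), t0 < t -> Z t = r%:E ->
        (\forall s \near t, Z s \is a fin_num) /\
        is_derive t (1 : R) (fun s => fine (Z s) - b s)
          (a + beta / 4 * t - r ^+ 2)
    & forall t, t0 < t -> Z t = +oo%E ->
        Z s @[s --> t^'-] --> -oo%E /\ Z s @[s --> t^'+] --> +oo%E].

(* Pathwise solution on [0, +oo) of the same equation, seen backward in time:
   when (as time decreases) it hits +oo at time tau it is restarted from -oo:
   convention Z(tau) = -oo, Z -> +oo as t -> tau^+, Z -> -oo as t -> tau^-.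
   At time 0 either Z(0) is finite and Z is right-continuous there, or the path
   hits +oo at time 0 (Z -> +oo as t -> 0^+) and then Z(0) = -oo. *)
Definition backward_sol {R : realType} (b : R -> R) (beta a : R)
  (Z : R -> \bar R) : Prop :=
  [/\ (exists r : R, Z 0 = r%:E /\ Z s @[s --> 0^'+] --> r%:E) \/
        (Z 0 = -oo%E /\ Z s @[s --> 0^'+] --> +oo%E),
      forall t, 0 <= t -> Z t != +oo%E,
      forall t (r : R), 0 < t -> Z t = r%:E ->
        (\forall s \near t, Z s \is a fin_num) /\
        is_derive t (1 : R) (fun s => fine (Z s) - b s)
          (a + beta / 4 * t - r ^+ 2)
    & forall t, 0 < t -> Z t = -oo%E ->
        Z s @[s --> t^'+] --> +oo%E /\ Z s @[s --> t^'-] --> -oo%E].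

(* Main.v *)
Require Import Defs.
From HB Require Import structures.
From mathcomp Require Import all_boot all_order all_algebra.
From mathcomp Require Import all_classical all_reals all_analysis.
From mathcomp Require Import measurable_realfun ring lra.
Import Order.TTheory GRing.Theory Num.Theory.
Import numFieldNormedType.Exports.
Local Open Scope classical_set_scope.
Local Open Scope ring_scope.

(** With [q t = a + beta/4 t], the substitution [Z = b + v/u] turns the
    Riccati equation into the linear system [u' = v + b u],
    [v' = (q - b^2) u - b v]: explosions of [Z] are zeros of [u], restarts are
    automatic, and two solutions of the linear system give the same path iff
    their (constant) Wronskian vanishes.

    If [g] is a subsolution, i.e. [g' <= q - (b + g)^2], then [u (v - g u)] is
    nondecreasing.  Averaging [b] over [[t, t + 1]] gives a differentiable [bt];
    almost surely the oscillation of [b] over unit intervals is at most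
    [eps sqrt t] for large [t], so [theta k sqrt t - bt t] is a subsolution for
    [|theta| <= 1].  Hence a path which is once above [- k sqrt t] (in particular
    one that explodes) is above [k sqrt t] after one unit of time and for ever;
    otherwise it stays below [- k sqrt t].  Paths of the second kind exist by
    compactness of the space of directions.  There is only one: a combination
    of two independent ones vanishing at a late time would be of the first kind,
    hence unbounded, whereas solutions of the second kind are bounded.

    The oscillation bound follows from Gaussian tails of the dyadic increments,
    Borel-Cantelli, and chaining. *)

(** * Calculus on the real line *)

Section Calculus.
Context {R : realType}.
Implicit Types (f g u v : R -> R) (x y t s a b l : R).

(** Linear approximation replaces the difference quotient: the bound also makes sense at [s = t], so
    that full neighbourhoods can be used throughout. *)
Lemma is_deriveP f t l : is_derive t 1 f l <->
  forall e, 0 < e -> \forall s \near t, `|f s - f t - l * (s - t)| <= e * `|s - t|.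
Proof.
have eqv : is_derive t 1 f l <->
    (fun h : R => h^-1 *: (f (h + t) - f t)) h @[h --> 0^'] --> l.
  split=> [[df <-]|cl].
    have -> : (fun h : R => h^-1 *: (f (h + t) - f t)) =
        (fun h => h^-1 *: ((f \o shift t) (h *: 1) - f t)).
      by apply/funext => h /=; rewrite [h *: 1]mulr1.
    exact: df.
  have cl' : (fun h : R => h^-1 *: ((f \o shift t) (h *: 1) - f t)) h
      @[h --> 0^'] --> l.
    suff -> : (fun h => h^-1 *: ((f \o shift t) (h *: 1) - f t)) =
      (fun h : R => h^-1 *: (f (h + t) - f t)) by [].
    by apply/funext => h /=; rewrite [h *: 1]mulr1.
  split; first by apply/cvg_ex; exists l.
  by apply/cvg_lim; first exact: Rhausdorff.
rewrite eqv; split=> [/cvgrPdist_le cl e e0|H].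
  have /= := cl e e0.
  rewrite /dnbhs/= => -[d /= d0 dH].
  exists d => //= s; rewrite /ball/= => ds.
  have [->|st] := eqVneq s t; first by rewrite !subrr mulr0 subrr normr0 mulr0.
  have st0 : s - t != 0 by rewrite subr_eq0.
  have := dH (s - t); rewrite /ball/= sub0r opprB => /(_ ds st0).
  rewrite subrK => le; rewrite -ler_pdivrMr ?normr_gt0//.
  rewrite -normfV -normrM mulrBl mulfK// distrC.
  by move: le; rewrite /GRing.scale/= [_^-1 * _]mulrC.
apply/cvgrPdist_le => e e0.
have [d /= d0 dH] := H e e0.
exists d => //= h; rewrite /ball/= sub0r normrN => hd h0.
have := dH (h + t); rewrite /ball/= opprD addrCA subrr addr0 normrN addrK => /(_ hd).
move=> le; rewrite -(ler_pM2r (x := `|h|)) ?normr_gt0// -normrM mulrBl.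
by rewrite /GRing.scale/= [_^-1 * _]mulrC divfK// distrC.
Qed.

Lemma is_derive_near f g t l : (\forall s \near t, f s = g s) ->
  is_derive t 1 f l -> is_derive t 1 g l.
Proof.
move=> fg /is_deriveP H; apply/is_deriveP => e e0.
have ft := nbhs_singleton fg.
by apply: filterS2 fg (H e e0) => s <-; rewrite ft.
Qed.

Lemma derive1D f g t a b : is_derive t 1 f a -> is_derive t 1 g b ->
  is_derive t 1 (fun s => f s + g s) (a + b).
Proof. by move=> fa gb; exact: is_deriveD. Qed.

Lemma derive1B f g t a b : is_derive t 1 f a -> is_derive t 1 g b ->
  is_derive t 1 (fun s => f s - g s) (a - b).
Proof. by move=> fa gb; exact: is_deriveB. Qed.

Lemma derive1M f g t a b : is_derive t 1 f a -> is_derive t 1 g b ->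
  is_derive t 1 (fun s => f s * g s) (a * g t + f t * b).
Proof.
move=> fa gb; apply: (is_derive_eq (is_deriveM fa gb)).
by rewrite /GRing.scale/= addrC mulrC.
Qed.

Lemma derive1cst c t : is_derive t 1 (fun=> c : R) (0 : R).
Proof. exact: is_derive_cst. Qed.

Lemma derive1cM c f t a : is_derive t 1 f a ->
  is_derive t 1 (fun s => c * f s) (c * a).
Proof.
move=> fa; apply: (is_derive_eq (derive1M _ _ _ _ _ (derive1cst c t) fa)).
by rewrite mul0r add0r.
Qed.

Lemma derive1cont f t a : is_derive t 1 f a -> {for t, continuous f}.
Proof. by move=> [df _]; apply/differentiable_continuous/derivable1_diffP. Qed.

Lemma derive1V f t a : f t != 0 -> is_derive t 1 f a ->
  is_derive t 1 (fun s => (f s)^-1) (- (f t) ^- 2 * a).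
Proof. by move=> ft fa; exact: is_deriveV. Qed.

Lemma derive1div f g t a b : g t != 0 -> is_derive t 1 f a ->
  is_derive t 1 g b ->
  is_derive t 1 (fun s => f s / g s) ((a * g t - f t * b) / g t ^+ 2).
Proof.
move=> gt0 fa gb; apply: (is_derive_eq (derive1M _ _ _ _ _ fa (derive1V _ _ _ gt0 gb))).
by field.
Qed.

Lemma derive1id t : is_derive t 1 (fun s : R => s) (1 : R).
Proof. exact: is_derive_id. Qed.

Lemma derive_continuous_itv f (df : R -> R) a b :
  (forall x, a <= x <= b -> is_derive x 1 f (df x)) ->
  {within `[a, b], continuous f}.
Proof.
move=> H; apply: derivable_within_continuous => x; rewrite in_itv/= => xab.
by have [] := H x xab.
Qed.

Lemma derive_MVT f (df : R -> R) a b : a <= b ->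
  (forall x, a <= x <= b -> is_derive x 1 f (df x)) ->
  exists2 c, a <= c <= b & f b - f a = df c * (b - a).
Proof.
move=> ab H; have [x| |c] := @MVT_segment R f df a b ab.
- by rewrite in_itv/= => /andP[ax xb]; apply: H; rewrite !ltW.
- exact: derive_continuous_itv H.
- by rewrite in_itv/=; exists c.
Qed.

Lemma derive_ge0_le f (df : R -> R) a b : a <= b ->
  (forall x, a <= x <= b -> is_derive x 1 f (df x)) ->
  (forall x, a <= x <= b -> 0 <= df x) -> f a <= f b.
Proof.
move=> ab H H0; have [c cab E] := derive_MVT _ _ _ _ ab H.
by rewrite -subr_ge0 E mulr_ge0 ?H0// subr_ge0.
Qed.

Lemma derive_norm_le f g (df dg : R -> R) a b : a <= b ->
  (forall x, a <= x <= b -> is_derive x 1 f (df x)) ->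
  (forall x, a <= x <= b -> is_derive x 1 g (dg x)) ->
  (forall x, a <= x <= b -> `|df x| <= dg x) -> `|f b - f a| <= g b - g a.
Proof.
move=> ab Hf Hg H; rewrite ler_norml; apply/andP; split.
  have : g a + f a <= g b + f b; last lra.
  apply: (derive_ge0_le (fun s => g s + f s) (fun s => dg s + df s)) => // x xab.
    by apply: derive1D; [exact: Hg|exact: Hf].
  by have := H x xab; rewrite ler_norml => /andP[]; lra.
have : g a - f a <= g b - f b; last lra.
apply: (derive_ge0_le (fun s => g s - f s) (fun s => dg s - df s)) => // x xab.
  by apply: derive1B; [exact: Hg|exact: Hf].
by have := H x xab; rewrite ler_norml => /andP[]; lra.
Qed.

(** Since [f] vanishes left of [l], it is integrable on every half-line []-oo, w]]; integrating from
    [-oo] gives a primitive on the whole line, without boundary points. *)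
Lemma primitive_ex f l : continuous f -> (forall x, x <= l -> f x = 0) ->
  exists F, (forall x, is_derive x 1 F (f x)) /\ (forall x, x <= l -> F x = 0).
Proof.
move=> cf f0.
have intf w : (@lebesgue_measure R).-integrable `]-oo, w] (EFin \o f).
  have E : EFin \o f = ((EFin \o f) \_ `[l, +oo[).
    apply/funext => x; rewrite patchE; case: ifPn => //.
    rewrite notin_setE/= in_itv/= andbT => /negP; rewrite -ltNge => /ltW xl.
    by rewrite f0.
  rewrite E; apply/integrable_restrict => //.
  have -> : `]-oo, w] `&` `[l, +oo[ = [set` `[l, w]].
    by apply/seteqP; split=> x /=; rewrite !in_itv/= andbT;
      [move=> [-> ->]|move=> /andP[]].
  apply: continuous_compact_integrable; first exact: segment_compact.
  exact: continuous_subspaceT.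
exists (fun x => \int[lebesgue_measure]_(t in `]-oo, x]) f t); split=> x.
  have [||dF EF] := @continuous_FTC1 R f -oo%O x (x + 1) _ (intf _) _ (cf x).
  - by rewrite ltrDl.
  - by rewrite ltNyr.
  by split => //; rewrite -derive1E.
move=> xl; rewrite /Rintegral (eq_integral (fun=> 0%E)) ?integral0//.
move=> y; rewrite inE/= in_itv/= => yx.
by rewrite f0// (le_trans yx).
Qed.

(** Subtracting and adding [2 * C / 2 ^+ n] gives two monotone sequences that bracket the limit,
    which is taken as the supremum of the lower one. *)
Lemma geometric_lim (x_ : nat -> R) C :
  (forall n, `|x_ n.+1 - x_ n| <= C / 2 ^+ n) ->
  exists l, forall n, `|x_ n - l| <= 2 * C / 2 ^+ n.
Proof.
move=> H; pose y n := x_ n + 2 * C / 2 ^+ n; pose z n := x_ n - 2 * C / 2 ^+ n.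
have p2 n : 0 < 2 ^+ n :> R by rewrite exprn_gt0.
have half n : C / 2 ^+ n.+1 = (C / 2 ^+ n) / 2.
  by rewrite exprS invfM [_^-1 * _]mulrC mulrA.
have yS n : y n.+1 <= y n.
  have := H n; rewrite /y ler_norml -!mulrA half => /andP[]; lra.
have zS n : z n <= z n.+1.
  have := H n; rewrite /z ler_norml -!mulrA half => /andP[]; lra.
have C0 : 0 <= C by have := H 0%N; rewrite expr0 divr1; apply: le_trans.
have zy n : z n <= y n.
  have := divr_ge0 C0 (ltW (p2 n)); rewrite /z /y -!mulrA; lra.
have zmono : {homo z : m n / (m <= n)%N >-> m <= n} by exact/nondecreasing_seqP.
have ymono : forall m n, (m <= n)%N -> y n <= y m.
  by move=> m n; apply: (nonincreasing_seqP _).1.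
have zley m n : z m <= y n.
  apply: (le_trans (zmono _ _ (leq_maxl m n))).
  by apply: (le_trans (zy _)); apply: ymono; exact: leq_maxr.
pose S := [set z n | n in [set: nat]].
have supS : has_sup S.
  split; first by exists (z 0%N), 0%N.
  by exists (y 0%N) => _ [n _ <-].
exists (sup S) => n.
have le1 : z n <= sup S by apply: sup_upper_bound => //; exists n.
have le2 : sup S <= y n by apply: sup_le_ub => [|_ [m _ <-]//]; case: supS.
by rewrite ler_norml; move: le1 le2; rewrite /z /y => ? ?; apply/andP; split; lra.
Qed.

End Calculus.

(** * Linear systems of ordinary differential equations *)

Section Picard.
Context {R : realType}.
Implicit Types (f g : R -> R) (x y t s l : R).

Lemma div_expr2_le (C e : R) : 0 < e -> exists n : nat, C / 2 ^+ n <= e.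
Proof.
move=> e0; have [n nC] : exists n : nat, `|C| / e < n%:R.
  by exists (Num.Def.trunc (`|C| / e)).+1; exact: truncnS_gt.
exists n; have h := ltW nC.
have h2 : n%:R <= 2 ^+ n :> R by rewrite -natrX ler_nat ltnW// ltn_expl.
rewrite ler_pdivrMr ?exprn_gt0//.
apply: (le_trans (ler_norm C)).
by move: (le_trans h h2); rewrite ler_pdivrMr// mulrC.
Qed.

Lemma norm_le_div_expr2_eq0 (C x : R) : (forall n : nat, `|x| <= C / 2 ^+ n) -> x = 0.
Proof.
move=> H; apply/eqP; rewrite -normr_le0; apply/ler_addgt0Pr => e e0.
by have [n nC] := div_expr2_le C e e0; rewrite add0r (le_trans (H n)).
Qed.

(** Picard iteration in the weighted norm [sup |f| / E], where [E] is the exponential of twice the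
    integral of the sum of the absolute values of the coefficients. One step contracts by 1/2 on the
    whole line, so existence is global at once. *)
Lemma linear_system_ex (al be ga de : R -> R) l x0 y0 :
  continuous al -> continuous be -> continuous ga -> continuous de ->
  (forall t, t <= l -> [/\ al t = 0, be t = 0, ga t = 0 & de t = 0]) ->
  exists u v : R -> R,
    [/\ forall t, is_derive t 1 u (al t * u t + be t * v t),
        forall t, is_derive t 1 v (ga t * u t + de t * v t),
        u l = x0 & v l = y0].
Proof.
move=> cal cbe cga cde vanish.
have cM f g : continuous f -> continuous g -> continuous (fun s => f s * g s).
  by move=> cf cg s; apply: cvgM; [exact: cf|exact: cg].
have cD f g : continuous f -> continuous g -> continuous (fun s => f s + g s).
  by move=> cf cg s; apply: cvgD; [exact: cf|exact: cg].
(* A total operator of primitives vanishing up to [l]; for functions outside its domain it returns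
   [f] itself as a dummy value. *)
have /boolp.choice[prim primP] : forall f, exists F : R -> R, continuous f ->
    (forall x, x <= l -> f x = 0) -> (forall x, is_derive x 1 F (f x)) /\
    (forall x, x <= l -> F x = 0).
  move=> f.
  have [cf|ncf] := pselect (continuous f); last by exists f.
  have [f0|nf0] := pselect (forall x, x <= l -> f x = 0); last by exists f.
  by have [F FP] := primitive_ex f l cf f0; exists F.
pose th t : R := `|al t| + `|be t| + (`|ga t| + `|de t|).
have cth : continuous th.
  move=> t; apply: cvgD; apply: cvgD; apply: cvg_norm;
  by [exact: cal|exact: cbe|exact: cga|exact: cde].
have th0 t : t <= l -> th t = 0.
  by move=> /vanish[a0 b0 c0 d0]; rewrite /th a0 b0 c0 d0 normr0 !addr0.
have [dTh Th0] := primP th cth th0.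
pose E t : R := expR (2 * prim th t).
have dE t : is_derive t 1 E (2 * th t * E t).
  have d2 := derive1cM 2 _ _ _ (dTh t).
  have d3 : is_derive t 1 E (expR (2 * prim th t) * (2 * th t)).
    exact: (@is_derive1_comp R expR (fun s => 2 * prim th s)).
  by apply: (is_derive_eq d3); rewrite mulrC.
have th_ge0 t : 0 <= th t by rewrite /th !addr_ge0.
have Ele s t : s <= t -> E s <= E t.
  move=> st; have p0 x : 0 <= 2 * th x * E x by rewrite !mulr_ge0// expR_ge0.
  exact: (derive_ge0_le _ _ _ _ st (fun x _ => dE x) (fun x _ => p0 x)).
have E1 t : t <= l -> E t = 1 by move=> tl; rewrite /E Th0// mulr0 expR0.
have Ege1 t : 1 <= E t.
  have [/E1->//|/ltW lt] := leP t l.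
  by rewrite -(E1 l)//; exact: Ele.
(* The contraction: [E] has derivative [2 * th * E], so integrating [th * C * E] from [l] yields at
   most [C / 2 * E]. *)
have bound (p q du dv w : R -> R) C : (forall t, `|p t| + `|q t| <= th t) ->
    (forall t, is_derive t 1 w (p t * du t + q t * dv t)) ->
    (forall t, t <= l -> w t = 0) ->
    (forall t, `|du t| <= C * E t) -> (forall t, `|dv t| <= C * E t) ->
    forall t, `|w t| <= C / 2 * E t.
  move=> pq dw w0 hdu hdv t.
  have C0 : 0 <= C.
    by have := hdu l; rewrite E1// mulr1; apply: le_trans.
  have CE0 s : 0 <= C * E s by rewrite mulr_ge0// expR_ge0.
  have [tl|/ltW lt] := leP t l.
    by rewrite w0// normr0 -mulrA mulrCA mulr_ge0// invr_ge0.
  have := @derive_norm_le R w (fun t => C / 2 * E t) _ _ l t lt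
    (fun x _ => dw x) (fun x _ => derive1cM (C / 2) _ _ _ (dE x)).
  rewrite (w0 l)// subr0 (E1 l)// => H.
  have {H} : `|w t| <= C / 2 * E t - C / 2 * 1; last first.
    by move=> /le_trans; apply; rewrite mulr1 gerBl divr_ge0.
  apply: H => x _.
  apply: (le_trans (ler_normD _ _)); rewrite !normrM.
  have := ler_wpM2l (normr_ge0 (p x)) (hdu x).
  have := ler_wpM2l (normr_ge0 (q x)) (hdv x).
  have := ler_wpM2r (CE0 x) (pq x).
  lra.
have pq1 t : `|al t| + `|be t| <= th t by rewrite /th lerDl addr_ge0.
have pq2 t : `|ga t| + `|de t| <= th t by rewrite /th lerDr addr_ge0.
pose G1 (p : (R -> R) * (R -> R)) s : R := al s * p.1 s + be s * p.2 s.
pose G2 (p : (R -> R) * (R -> R)) s : R := ga s * p.1 s + de s * p.2 s.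
pose step p : (R -> R) * (R -> R) :=
  (fun t => x0 + prim (G1 p) t, fun t => y0 + prim (G2 p) t).
pose cont2 (p : (R -> R) * (R -> R)) := continuous p.1 /\ continuous p.2.
have G1P p : cont2 p -> (forall x, is_derive x 1 (prim (G1 p)) (G1 p x)) /\
    (forall x, x <= l -> prim (G1 p) x = 0).
  move=> [c1 c2]; apply: primP; first by apply: cD; apply: cM.
  by move=> x /vanish[a0 b0 _ _]; rewrite /G1 a0 b0 !mul0r addr0.
have G2P p : cont2 p -> (forall x, is_derive x 1 (prim (G2 p)) (G2 p x)) /\
    (forall x, x <= l -> prim (G2 p) x = 0).
  move=> [c1 c2]; apply: primP; first by apply: cD; apply: cM.
  by move=> x /vanish[_ _ a0 b0]; rewrite /G2 a0 b0 !mul0r addr0.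
have d1 p x : cont2 p -> is_derive x 1 (step p).1 (G1 p x).
  move=> cp; apply: (is_derive_eq (derive1D _ _ _ _ _ (derive1cst x0 x) ((G1P p cp).1 x))).
  by rewrite add0r.
have d2 p x : cont2 p -> is_derive x 1 (step p).2 (G2 p x).
  move=> cp; apply: (is_derive_eq (derive1D _ _ _ _ _ (derive1cst y0 x) ((G2P p cp).1 x))).
  by rewrite add0r.
have cstep p : cont2 p -> cont2 (step p).
  by move=> cp; split=> x; [exact: derive1cont (d1 p x cp)|
                           exact: derive1cont (d2 p x cp)].
pose it n := iter n step (fun=> x0, fun=> y0).
have cit n : cont2 (it n).
  elim: n => [|n IH]; last exact: cstep.
  by split=> x; exact: cvg_cst.
pose K : R := `|x0| + `|y0|.
have diff n t : `|(it n.+1).1 t - (it n).1 t| <= K / 2 ^+ n * E t /\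
                `|(it n.+1).2 t - (it n).2 t| <= K / 2 ^+ n * E t.
  elim: n t => [|n IH] t.
    have KE s : K <= K * E s by rewrite ler_peMr// addr_ge0.
    have KE2 : K / 2 * E t <= K / 2 ^+ 0 * E t.
      rewrite expr0 ler_wpM2r ?expR_ge0// ler_wpM2l ?addr_ge0// invr1.
      by rewrite invf_le1// ler1n.
    have [dg1 g10] := G1P _ (cit 0%N); have [dg2 g20] := G2P _ (cit 0%N).
    split; apply: le_trans KE2; rewrite /= addrAC subrr add0r.
      apply: (bound _ _ _ _ _ _ pq1 dg1 g10) => s /=;
      by apply: le_trans (KE s); rewrite ?lerDl ?lerDr.
    apply: (bound _ _ _ _ _ _ pq2 dg2 g20) => s /=;
    by apply: le_trans (KE s); rewrite ?lerDl ?lerDr.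
  have -> : K / 2 ^+ n.+1 = K / 2 ^+ n / 2 by rewrite exprS invfM mulrCA mulrC.
  have [dg1 g10] := G1P _ (cit n); have [dg2 g20] := G2P _ (cit n).
  have [dh1 h10] := G1P _ (cit n.+1); have [dh2 h20] := G2P _ (cit n.+1).
  split.
    apply: (bound al be (fun s => (it n.+1).1 s - (it n).1 s)
      (fun s => (it n.+1).2 s - (it n).2 s)
      (fun s => (it n.+2).1 s - (it n.+1).1 s)) => // [s|s sl|s|s].
    - apply: (is_derive_eq (derive1B _ _ _ _ _ (d1 _ s (cit n.+1)) (d1 _ s (cit n)))).
      by rewrite /G1; ring.
    - by rewrite /= h10// g10// subrr.
    - by case: (IH s).
    - by case: (IH s).
  apply: (bound ga de (fun s => (it n.+1).1 s - (it n).1 s)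
      (fun s => (it n.+1).2 s - (it n).2 s)
      (fun s => (it n.+2).2 s - (it n.+1).2 s)) => // [s|s sl|s|s].
  - apply: (is_derive_eq (derive1B _ _ _ _ _ (d2 _ s (cit n.+1)) (d2 _ s (cit n)))).
    by rewrite /G2; ring.
  - by rewrite /= h20// g20// subrr.
  - by case: (IH s).
  - by case: (IH s).
have /boolp.choice[U UP] : forall t, exists L, forall n,
    `|(it n).1 t - L| <= 2 * K / 2 ^+ n * E t.
  move=> t.
  have [n|L LP] := geometric_lim (fun n => (it n).1 t) (K * E t).
    by rewrite mulrAC; case: (diff n t).
  by exists L => n; have := LP n; rewrite mulrA mulrAC.
have /boolp.choice[V VP] : forall t, exists L, forall n,
    `|(it n).2 t - L| <= 2 * K / 2 ^+ n * E t.
  move=> t.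
  have [n|L LP] := geometric_lim (fun n => (it n).2 t) (K * E t).
    by rewrite mulrAC; case: (diff n t).
  by exists L => n; have := LP n; rewrite mulrA mulrAC.
have K0 : 0 <= K by rewrite addr_ge0.
have unifc (f_ : nat -> R -> R) f : (forall n, continuous (f_ n)) ->
    (forall t n, `|f_ n t - f t| <= 2 * K / 2 ^+ n * E t) -> continuous f.
  move=> cf_ H t; apply/cvgrPdist_le => e e0.
  have e3 : 0 < e / 3 by rewrite divr_gt0.
  (* [E] is nondecreasing, so its value at [t + 1] bounds the error uniformly for [s] near [t]. *)
  have [n nC] := div_expr2_le (2 * K * E (t + 1)) _ e3.
  have /cvgrPdist_le/(_ _ e3) Hn := cf_ n t.
  near=> s.
  have st : s <= t + 1.
    rewrite -lerBlDl; apply: (le_trans (ler_norm _)); rewrite distrC.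
    by near: s; exact: cvgr_dist_le.
  have b1 : `|f_ n s - f s| <= e / 3.
    apply: (le_trans (H s n)); apply: le_trans nC; rewrite mulrAC.
    by rewrite ler_wpM2r ?invr_ge0 ?exprn_ge0// ler_wpM2l ?mulr_ge0// Ele.
  have b2 : `|f_ n t - f t| <= e / 3.
    apply: (le_trans (H t n)); apply: le_trans nC; rewrite mulrAC.
    by rewrite ler_wpM2r ?invr_ge0 ?exprn_ge0// ler_wpM2l ?mulr_ge0// Ele// lerDl.
  have b3 : `|f_ n t - f_ n s| <= e / 3 by near: s.
  move: b1 b2 b3; rewrite !ler_norml => /andP[? ?] /andP[? ?] /andP[? ?].
  by apply/andP; split; lra.
have cUV : cont2 (U, V).
  split; first by apply: (unifc (fun n => (it n).1)) => // n; case: (cit n).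
  by apply: (unifc (fun n => (it n).2)) => // n; case: (cit n).
have half n : 2 * K / 2 ^+ n / 2 = K / 2 ^+ n by field; rewrite expf_neq0.
have [gd1 g10] := G1P _ cUV; have [gd2 g20] := G2P _ cUV.
(* The limit is a fixed point: both sides lie within [K / 2 ^+ n * E t] of the same iterate, for
   every [n]. *)
have EU t : U t = (step (U, V)).1 t.
  apply/eqP; rewrite -subr_eq0; apply/eqP.
  apply: (norm_le_div_expr2_eq0 (2 * K * E t)) => n.
  have h1 := UP t n.+1.
  have h2 : `|(it n.+1).1 t - (step (U, V)).1 t| <= 2 * K / 2 ^+ n / 2 * E t.
    have [dg g0] := G1P _ (cit n).
    apply: (bound al be (fun s => (it n).1 s - U s) (fun s => (it n).2 s - V s)
      (fun s => (it n.+1).1 s - (step (U, V)).1 s)) => // [s|s sl].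
      apply: (is_derive_eq (derive1B _ _ _ _ _ (d1 _ s (cit n)) (d1 _ s cUV))).
      by rewrite /G1/=; ring.
    by rewrite /= g0// g10// subrr.
  rewrite -(subrKA ((it n.+1).1 t)) [2 * K * _]mulrC -mulrA mulrC.
  apply: (le_trans (ler_normD _ _)); rewrite distrC.
  have h3 : 2 * K / 2 ^+ n.+1 = K / 2 ^+ n by rewrite exprS; field; rewrite expf_neq0.
  rewrite h3 in h1; rewrite half in h2.
  have -> : 2 * K / 2 ^+ n * E t = K / 2 ^+ n * E t + K / 2 ^+ n * E t by ring.
  exact: lerD.
have EV t : V t = (step (U, V)).2 t.
  apply/eqP; rewrite -subr_eq0; apply/eqP.
  apply: (norm_le_div_expr2_eq0 (2 * K * E t)) => n.
  have h1 := VP t n.+1.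
  have h2 : `|(it n.+1).2 t - (step (U, V)).2 t| <= 2 * K / 2 ^+ n / 2 * E t.
    have [dg g0] := G2P _ (cit n).
    apply: (bound ga de (fun s => (it n).1 s - U s) (fun s => (it n).2 s - V s)
      (fun s => (it n.+1).2 s - (step (U, V)).2 s)) => // [s|s sl].
      apply: (is_derive_eq (derive1B _ _ _ _ _ (d2 _ s (cit n)) (d2 _ s cUV))).
      by rewrite /G2/=; ring.
    by rewrite /= g0// g20// subrr.
  rewrite -(subrKA ((it n.+1).2 t)) [2 * K * _]mulrC -mulrA mulrC.
  apply: (le_trans (ler_normD _ _)); rewrite distrC.
  have h3 : 2 * K / 2 ^+ n.+1 = K / 2 ^+ n by rewrite exprS; field; rewrite expf_neq0.
  rewrite h3 in h1; rewrite half in h2.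
  have -> : 2 * K / 2 ^+ n * E t = K / 2 ^+ n * E t + K / 2 ^+ n * E t by ring.
  exact: lerD.
exists U, V; split=> [t|t||].
- by rewrite {1}(_ : U = (step (U, V)).1); [exact: d1|exact/funext].
- by rewrite {1}(_ : V = (step (U, V)).2); [exact: d2|exact/funext].
- by rewrite EU/= g10// addr0.
- by rewrite EV/= g20// addr0.
Unshelve. all: by end_near. Qed.

End Picard.

(** * The linear system attached to the Riccati equation *)

Section LinearSystem.
Context {R : realType} (b : R -> R) (a c : R).
Hypothesis cb : continuous b.
Implicit Types (u v w z g : R -> R) (s t x y : R).

Definition lin u v := forall t, 0 <= t ->
  is_derive t 1 u (v t + b t * u t) /\
  is_derive t 1 v ((a + c * t - b t ^+ 2) * u t - b t * v t).

Definition wron u v w z t : R := u t * z t - w t * v t.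

Lemma lin_comb x y u v w z : lin u v -> lin w z ->
  lin (fun t => x * u t + y * w t) (fun t => x * v t + y * z t).
Proof.
move=> l1 l2 t t0; have [du dv] := l1 t t0; have [dw dz] := l2 t t0; split.
  apply: (is_derive_eq (derive1D _ _ _ _ _ (derive1cM x _ _ _ du)
    (derive1cM y _ _ _ dw))); ring.
apply: (is_derive_eq (derive1D _ _ _ _ _ (derive1cM x _ _ _ dv)
  (derive1cM y _ _ _ dz))); ring.
Qed.

Lemma wron_cst u v w z s t : lin u v -> lin w z -> 0 <= s -> 0 <= t ->
  wron u v w z s = wron u v w z t.
Proof.
move=> l1 l2; wlog st : s t / s <= t => [H s0 t0|s0 t0].
  by have [st|/ltW ts] := leP s t; [exact: H|apply/esym/H].
have dW x : s <= x <= t -> is_derive x 1 (wron u v w z) 0.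
  move=> /andP[sx _]; have x0 := le_trans s0 sx.
  have [du dv] := l1 x x0; have [dw dz] := l2 x x0.
  apply: (is_derive_eq (derive1B _ _ _ _ _ (derive1M _ _ _ _ _ du dz)
    (derive1M _ _ _ _ _ dw dv))); ring.
have [x _ E] := derive_MVT _ (fun=> 0) _ _ st dW.
by apply/esym/eqP; rewrite -subr_eq0 E mul0r.
Qed.

(** The cutoff [chi] is 1 on nonnegative times and 0 before [-2], so the global existence result
    applies and its solutions satisfy [lin]. *)
Lemma lin_fundamental : exists u v w z,
  [/\ lin u v, lin w z & forall t, 0 <= t -> wron u v w z t = 1].
Proof.
pose chi t : R := Num.max 0 (Num.min 1 (t + 2)).
have cid2 : continuous (fun t : R => t + 2).
  by move=> t; apply: cvgD; [exact: cvg_id|exact: cvg_cst].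
have cchi : continuous chi.
  have cmin : continuous (fun t : R => Num.min 1 (t + 2)).
    move=> t; apply: (@continuous_min R R (fun=> 1) (fun t => t + 2)).
      exact: cvg_cst.
    exact: cid2.
  move=> t; apply: (@continuous_max R R (fun=> 0) (fun t => Num.min 1 (t + 2))).
    exact: cvg_cst.
  exact: cmin.
have chi0 t : t <= -2 -> chi t = 0.
  move=> t2; rewrite /chi; apply: max_l; rewrite ge_min; apply/orP; right; lra.
have chi1 t : 0 <= t -> chi t = 1.
  by move=> t0; rewrite /chi min_l ?max_r//; lra.
have c1 : continuous (fun t => chi t * b t).
  by move=> t; apply: cvgM; [exact: cchi|exact: cb].
have c2 : continuous (fun t => chi t * (a + c * t - b t ^+ 2)).
  move=> t; apply: cvgM; first exact: cchi.
  apply: cvgB; first by apply: cvgD; [exact: cvg_cst|apply: cvgMr; exact: cvg_id].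
  by apply: (@cvgM _ _ (nbhs t) _ b b (b t) (b t)); exact: cb.
have c3 : continuous (fun t => - (chi t * b t)).
  by move=> t; apply: cvgN; exact: c1.
have van t : t <= -2 -> [/\ chi t * b t = 0, chi t = 0,
    chi t * (a + c * t - b t ^+ 2) = 0 & - (chi t * b t) = 0].
  by move=> /chi0 ->; rewrite !mul0r oppr0.
have [u [v [du dv u1 v1]]] := linear_system_ex _ _ _ _ _ 1 0 c1 cchi c2 c3 van.
have [w [z [dw dz w1 z1]]] := linear_system_ex _ _ _ _ _ 0 1 c1 cchi c2 c3 van.
have luv : lin u v.
  move=> t t0; split; [apply: (is_derive_eq (du t))|apply: (is_derive_eq (dv t))];
  by rewrite chi1//; ring.
have lwz : lin w z.
  move=> t t0; split; [apply: (is_derive_eq (dw t))|apply: (is_derive_eq (dz t))];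
  by rewrite chi1//; ring.
exists u, v, w, z; split=> // t t0.
(* The cut-off system has trace zero at all times, negative ones included; the Wronskian thus keeps
   its value 1 from time [-2]. *)
have dW x : is_derive x 1 (wron u v w z) 0.
  apply: (is_derive_eq (derive1B _ _ _ _ _ (derive1M _ _ _ _ _ (du x) (dz x))
    (derive1M _ _ _ _ _ (dw x) (dv x)))); ring.
rewrite (is_derive_0_is_cst t (-2) dW) /wron u1 v1 w1 z1; ring.
Qed.

Lemma lin_ex t0 x y : 0 <= t0 -> exists u v, [/\ lin u v, u t0 = x & v t0 = y].
Proof.
move=> t00; have [u [v [w [z [l1 l2 W]]]]] := lin_fundamental.
have W0 := W t0 t00; rewrite /wron in W0.
(* Cramer's rule at [t0], where the determinant is 1. *)
exists (fun t => (x * z t0 - y * w t0) * u t + (y * u t0 - x * v t0) * w t).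
exists (fun t => (x * z t0 - y * w t0) * v t + (y * u t0 - x * v t0) * z t).
split; first exact: lin_comb.
- by rewrite -[RHS]mulr1 -W0; ring.
- by rewrite -[RHS]mulr1 -W0; ring.
Qed.

(** For a solution of the linear system this is nontriviality: [(u, v)] then has a direction at
    every time, and this direction encodes the value of the Riccati path. *)
Definition nz u v := forall t, 0 <= t -> u t = 0 -> v t != 0.

(** Against the solution that equals [(- v t0, u t0)] at [t0], the constant Wronskian is
    [u t0 ^+ 2 + v t0 ^+ 2]; it would vanish at a common zero of [u] and [v]. *)
Lemma lin_nz u v t0 : lin u v -> 0 <= t0 -> (u t0 != 0) || (v t0 != 0) -> nz u v.
Proof.
move=> l1 t00 h.
have [w [z [l2 w0 z0]]] := lin_ex t0 (- v t0) (u t0) t00.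
move=> t tt0 ut; apply/eqP => vt.
have := wron_cst _ _ _ _ _ _ l1 l2 tt0 t00.
rewrite /wron ut vt w0 z0 mul0r mulr0 subr0 => /esym/eqP.
rewrite mulNr opprK -!expr2 paddr_eq0 ?sqr_ge0// !sqrf_eq0.
by move=> /andP[/eqP u0 /eqP v0]; move: h; rewrite u0 v0 eqxx.
Qed.

(** The derivative is [(v - g u)^2] plus the defect of the subsolution times [u^2]. The product
    form, unlike [v / u - g], passes through the zeros of [u], that is, through explosions. *)
Lemma lin_barrier u v g (dg : R -> R) s t : lin u v -> 0 <= s -> s <= t ->
  (forall x, s <= x <= t -> is_derive x 1 g (dg x)) ->
  (forall x, s <= x <= t -> 0 <= a + c * x - (b x + g x) ^+ 2 - dg x) ->
  u s * (v s - g s * u s) <= u t * (v t - g t * u t).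
Proof.
move=> l1 s0 st hg hK.
apply: (derive_ge0_le (fun x => u x * (v x - g x * u x))
  (fun x => (v x - g x * u x) ^+ 2 +
            (a + c * x - (b x + g x) ^+ 2 - dg x) * u x ^+ 2) s t st) => x sxt.
  have [du dv] := l1 x (le_trans s0 (andP sxt).1).
  apply: (is_derive_eq (derive1M _ _ _ _ _ du (derive1B _ _ _ _ _ dv
    (derive1M _ _ _ _ _ (hg x sxt) du)))); ring.
by rewrite addr_ge0 ?sqr_ge0// mulr_ge0 ?sqr_ge0// hK.
Qed.

Lemma sqr_derive u v t : lin u v -> 0 <= t ->
  is_derive t 1 (fun s => u s ^+ 2) (2 * (u t * (v t + b t * u t))).
Proof.
move=> l1 t0; have [du dv] := l1 t t0.
have -> : (fun s => u s ^+ 2) = (fun s => u s * u s) by apply/funext => s; rewrite expr2.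
apply: (is_derive_eq (derive1M _ _ _ _ _ du du)); ring.
Qed.

End LinearSystem.

(** * Dominant and recessive solutions *)

Section Asymptotics.
Context {R : realType} (b : R -> R) (a k T0 : R).
Hypothesis cb : continuous b.
Hypothesis b0 : forall t, t <= 0 -> b t = 0.
Hypothesis k0 : 0 < k.
Hypothesis osc : forall t s, T0 <= t -> t <= s <= t + 1 ->
  `|b s - b t| <= k / 2 * Num.sqrt t.
Implicit Types (u v w z g : R -> R) (s t x y : R).

Local Notation lin := (lin b a (16 * k ^+ 2)).

Let T1 := Num.max T0 (Num.max 1 (((1 + `|a|) / k) ^+ 2)).

Let T1_ge1 : 1 <= T1. Proof. by rewrite /T1 !le_max lexx orbT. Qed.

Let T1_ge0 t : T1 <= t -> 0 <= t.
Proof. by move=> T1t; rewrite (le_trans _ (le_trans T1_ge1 T1t)). Qed.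

Let T1_sqrt t : T1 <= t ->
  [/\ T0 <= t, 1 <= Num.sqrt t, Num.sqrt t ^+ 2 = t & 1 + `|a| <= k * Num.sqrt t].
Proof.
move=> T1t; have t1 := le_trans T1_ge1 T1t; split.
- by apply: le_trans T1t; rewrite /T1 le_max lexx.
- by rewrite -sqrtr1 ler_wsqrtr.
- by rewrite sqr_sqrtr// T1_ge0.
- rewrite mulrC -ler_pdivrMr//.
  have p0 : 0 <= (1 + `|a|) / k by rewrite divr_ge0 ?addr_ge0// ltW.
  rewrite -[leLHS](ger0_norm p0) -sqrtr_sqr ler_wsqrtr//.
  by apply: le_trans T1t; rewrite /T1 !le_max lexx !orbT.
Qed.

(** [bt t] is the mean of [b] over [[t, t + 1]], hence by the mean value theorem a value of [b] on
    that interval, to which [osc] applies. *)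
Lemma averaged_ex : exists bt : R -> R,
  (forall t, is_derive t 1 bt (b (t + 1) - b t)) /\
  (forall t, T0 <= t -> `|b t - bt t| <= k / 2 * Num.sqrt t).
Proof.
have [F [dF _]] := primitive_ex b 0 cb b0.
have dF1 t : is_derive t 1 (fun s => F (s + 1)) (b (t + 1)).
  have d1 := derive1D _ _ _ _ _ (derive1id t) (derive1cst 1 t).
  apply: (is_derive_eq (@is_derive1_comp R F (fun s => s + 1) t _ _ (dF (t + 1)) d1)).
  by rewrite addr0 mulr1.
exists (fun t => F (t + 1) - F t); split=> t; first exact: derive1B.
move=> T0t; have [|s st E] := derive_MVT F b t (t + 1) _ (fun x _ => dF x).
  by rewrite lerDl.
by rewrite E addrAC subrr add0r mulr1 distrC; exact: osc.
Qed.

(** * Moving barriers and the dichotomy between dominant and recessive solutions *)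

Section Barriers.
Variable bt : R -> R.
Hypothesis dbt : forall t, is_derive t 1 bt (b (t + 1) - b t).
Hypothesis eta : forall t, T0 <= t -> `|b t - bt t| <= k / 2 * Num.sqrt t.

(* [0 <= Q u v th t] means [u t = 0] or
   [th * (k * sqrt t) + (b t - bt t) <= b t + v t / u t]. *)
Let Q u v th t : R := u t * (v t - (th * (k * Num.sqrt t) - bt t) * u t).

(** A level moving with slope at most 2 can climb from -1 to 1 in one unit of time. With
    [p = k * sqrt x >= 1], the drift contributes [16 p^2]; the square takes at most [9/4 p^2] and
    all remaining terms at most [9/2 p]. *)
Lemma barrier_ramp u v (l0 l1 s t : R) : lin u v -> T1 <= s -> s <= t ->
  `|l1| <= 2 -> (forall x, s <= x <= t -> `|l0 + l1 * x| <= 1) ->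
  Q u v (l0 + l1 * s) s <= Q u v (l0 + l1 * t) t.
Proof.
move=> luv T1s st hl1 hth.
apply: (lin_barrier b a (16 * k ^+ 2) u v
  (fun x => (l0 + l1 * x) * (k * Num.sqrt x) - bt x)
  (fun x => l1 * (k * Num.sqrt x) + (l0 + l1 * x) * (k * (2 * Num.sqrt x)^-1)
    - (b (x + 1) - b x)) s t luv (T1_ge0 _ T1s) st) => x sxt.
  have /andP[sx _] := sxt; have T1x := le_trans T1s sx.
  have x0 : 0 < x by rewrite (lt_le_trans _ (le_trans T1_ge1 T1x)).
  have d1 := derive1D _ _ _ _ _ (derive1cst l0 x) (derive1cM l1 _ _ _ (derive1id x)).
  have d2 := derive1cM k _ _ _ (is_derive1_sqrt x0).
  apply: (is_derive_eq (derive1B _ _ _ _ _ (derive1M _ _ _ _ _ d1 d2) (dbt x))).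
  by rewrite add0r mulr1.
have /andP[sx _] := sxt; have T1x := le_trans T1s sx.
have [T0x r1 r2 r3] := T1_sqrt x T1x.
have := eta x T0x.
have : `|b (x + 1) - b x| <= k / 2 * Num.sqrt x by apply: osc => //; rewrite lexx lerDl ler01.
have := hth x sxt.
set th := l0 + l1 * x; rewrite -[X in 16 * k ^+ 2 * X]r2.
set r := Num.sqrt x in r1 r2 r3 *.
set e := b x - bt x; set d := b (x + 1) - b x => hth1 hd he.
have -> : b x + (th * (k * r) - bt x) = e + th * (k * r) by rewrite /e; ring.
set p := k * r in r3 *.
have p0 : 1 <= p by apply: le_trans r3; rewrite lerDl.
have hth2 : `|th * p| <= p.
  by rewrite normrM (ger0_norm (le_trans ler01 p0)) ler_piMl// (le_trans ler01).
have he2 : `|e| <= p / 2 by rewrite /p mulrAC.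
have hd2 : `|d| <= p / 2 by rewrite /p mulrAC.
have hl : `|l1 * p| <= 2 * p.
  by rewrite normrM (ger0_norm (le_trans ler01 p0)) ler_wpM2r// (le_trans ler01).
have hq : `|th * (k * (2 * r)^-1)| <= p.
  have r0 : 0 < r by exact: lt_le_trans r1.
  have q0 : 0 <= k * (2 * r)^-1 by rewrite mulr_ge0 ?invr_ge0 ?mulr_ge0// ltW.
  rewrite normrM (ger0_norm q0); apply: (@le_trans _ _ (k * (2 * r)^-1)).
    by rewrite ler_piMl.
  rewrite /p ler_wpM2l ?(ltW k0)// invf_ple ?posrE ?mulr_gt0//.
  have : r^-1 <= 1 by rewrite invf_le1.
  by move: r1; lra.
have sq : (e + th * p) ^+ 2 <= 9 / 4 * p ^+ 2.
  have : `|e + th * p| <= 3 / 2 * p.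
    by apply: (le_trans (ler_normD _ _)); move: he2 hth2; lra.
  rewrite ler_norml => /andP[h1 h2]; nra.
have ha : - `|a| <= a by rewrite lerNl -normrN ler_norm.
have -> : 16 * k ^+ 2 * r ^+ 2 = 16 * p ^+ 2 by rewrite /p; ring.
move: hq hl hd2; rewrite !ler_norml => /andP[_ q2] /andP[_ q4] /andP[q5 _].
have pp : p <= p ^+ 2 by rewrite expr2 ler_peMl// (le_trans ler01).
lra.
Qed.

Lemma barrier_cst u v th s t : lin u v -> T1 <= s -> s <= t -> `|th| <= 1 ->
  Q u v th s <= Q u v th t.
Proof.
move=> luv T1s st hth.
have := barrier_ramp u v th 0 s t luv T1s st.
rewrite normr0 !mul0r !addr0; apply => // x _.
by rewrite mul0r addr0.
Qed.

(** The factor 1/2 absorbs the gap between [b] and [bt], so that neither this notion nor [recessive]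
    refers to [bt]. *)
Definition dominant u v := exists T, forall t, T <= t ->
  u t != 0 /\ k / 2 * Num.sqrt t <= b t + v t / u t.

Definition recessive u v := exists T, forall t, T <= t ->
  u t != 0 /\ b t + v t / u t <= - (k / 2 * Num.sqrt t).

Let QE u v th t : u t != 0 ->
  Q u v th t = u t ^+ 2 * (v t / u t + bt t - th * (k * Num.sqrt t)).
Proof. by move=> u0; rewrite /Q; field. Qed.

(** The ramp lifts the lower bound from level -1 to level 1 during [[t1, t1 + 1]], and the constant
    barrier keeps it there. From then on [u^2] is nondecreasing. *)
Lemma Q_dominant u v t1 : lin u v -> nz u v -> T1 <= t1 -> 0 <= Q u v (-1) t1 ->
  dominant u v.
Proof.
move=> luv nuv T1t1 Q0.
have T12 : T1 <= t1 + 1 by rewrite (le_trans T1t1)// lerDl.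
have Q1 : 0 <= Q u v 1 (t1 + 1).
  have := barrier_ramp u v (-1 - 2 * t1) 2 t1 (t1 + 1) luv T1t1.
  have -> : -1 - 2 * t1 + 2 * t1 = -1 by ring.
  have -> : -1 - 2 * t1 + 2 * (t1 + 1) = 1 by ring.
  move=> H; apply: (le_trans Q0); apply: H.
  - by rewrite lerDl.
  - by rewrite ger0_norm.
  - by move=> x /andP[h1 h2]; rewrite ler_norml; apply/andP; split; lra.
have Q1t t : t1 + 1 <= t -> 0 <= Q u v 1 t.
  move=> t1t; apply: (le_trans Q1); apply: barrier_cst => //.
  by rewrite normr1.
have sqp t : t1 + 1 <= t -> 0 <= 2 * (u t * (v t + b t * u t)).
  move=> t1t; have [T0t r1 _ _] := T1_sqrt t (le_trans T12 t1t).
  have := Q1t t t1t; have := eta t T0t; rewrite /Q ler_norml => /andP[h1 h2].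
  have p0 : 0 <= k * Num.sqrt t by rewrite mulr_ge0 ?sqrtr_ge0// ltW.
  have : 0 <= (b t - bt t + k * Num.sqrt t) * u t ^+ 2.
    by rewrite mulr_ge0 ?sqr_ge0//; lra.
  lra.
(* By monotonicity of [u^2], a zero at [t] forces [u = 0] on all of [[t1 + 1, t]]; then [u'], hence
   [v], vanishes somewhere inside, against [nz]. *)
have un0 t : t1 + 1 < t -> u t != 0.
  move=> t1t; apply/eqP => ut0.
  have u0 s : t1 + 1 <= s <= t -> u s = 0.
    move=> /andP[h1 h2]; apply/eqP; rewrite -sqrf_eq0 eq_le sqr_ge0 andbT.
    have -> : 0 = u t ^+ 2 by rewrite ut0 expr0n.
    apply: (derive_ge0_le (fun s => u s ^+ 2)
      (fun s => 2 * (u s * (v s + b s * u s))) s t h2) => x /andP[sx _].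
      by apply: (sqr_derive _ _ _ _ _ _ luv); apply: T1_ge0; rewrite (le_trans T12)// (le_trans h1).
    by apply: sqp; rewrite (le_trans h1).
  have [|x xt E] := derive_MVT u (fun x => v x + b x * u x) _ _ (ltW t1t).
    by move=> x /andP[h1 _]; have [] := luv x (T1_ge0 _ (le_trans T12 h1)).
  have x0 : 0 <= x by case/andP: xt => h1 _; rewrite T1_ge0// (le_trans T12).
  have := nuv x x0 (u0 x xt).
  move/eqP : E; rewrite (u0 x xt) ut0 (u0 (t1 + 1)) ?lexx ?ltW// subrr mulr0 addr0 eq_sym mulf_eq0.
  by rewrite subr_eq0 (gt_eqF t1t) orbF => ->.
(* [u] may still vanish at [t1 + 1] itself, so the threshold is moved strictly beyond it. *)
exists (t1 + 2) => t t1t.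
have t1t' : t1 + 1 < t by lra.
split; first exact: un0.
have [T0t r1 _ _] := T1_sqrt t (le_trans T12 (ltW t1t')).
have := Q1t t (ltW t1t'); rewrite QE ?un0// mul1r pmulr_rge0 ?exprn_even_gt0/= ?un0//.
have := eta t T0t; rewrite ler_norml => /andP[h1 h2].
lra.
Qed.

(** Either [Q] at level -1 is nonnegative at some late time, or it is negative at all of them;
    negativity excludes zeros of [u] and gives the upper bound. *)
Lemma dominant_or_recessive u v : lin u v -> nz u v ->
  dominant u v \/ recessive u v.
Proof.
move=> luv nuv.
have [[t1 T1t1 Q0]|H] := pselect (exists2 t1, T1 <= t1 & 0 <= Q u v (-1) t1).
  by left; exact: Q_dominant Q0.
right; exists T1 => t T1t.
have Qn : Q u v (-1) t < 0.
  by rewrite ltNge; apply/negP => Q0; apply: H; exists t.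
have un0 : u t != 0 by apply/eqP => u0; move: Qn; rewrite /Q u0 mul0r ltxx.
split=> //; have [T0t r1 _ _] := T1_sqrt t T1t.
move: Qn; rewrite QE// pmulr_rlt0 ?exprn_even_gt0//=.
have := eta t T0t; rewrite ler_norml => /andP[h1 h2].
lra.
Qed.

Lemma zero_dominant u v t : lin u v -> nz u v -> T1 <= t -> u t = 0 -> dominant u v.
Proof.
move=> luv nuv T1t ut; apply: (Q_dominant _ _ t luv nuv T1t).
by rewrite /Q ut mul0r.
Qed.

(** The inequality is strict because it has to contradict a bound [Q <= 0] obtained in a limit. *)
Lemma dominant_Q u v : dominant u v ->
  exists T, forall t, T <= t -> 0 < Q u v (-1) t.
Proof.
move=> [T H]; exists (Num.max T T1) => t; rewrite ge_max => /andP[Tt T1t].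
have [un0 h] := H t Tt; have [T0t r1 _ _] := T1_sqrt t T1t.
rewrite QE// pmulr_rgt0 ?exprn_even_gt0//=.
have := eta t T0t; rewrite ler_norml => /andP[h1 h2].
have p0 : 0 < k * Num.sqrt t by rewrite mulr_gt0// (lt_le_trans _ r1).
lra.
Qed.

(** Here [u' / u = b + v / u] is nonpositive, so [u^2] is eventually nonincreasing. *)
Lemma recessive_bounded u v : lin u v -> recessive u v ->
  exists T C, forall t, T <= t -> u t ^+ 2 <= C.
Proof.
move=> luv [T H]; pose T2 := Num.max T 0.
exists T2, (u T2 ^+ 2) => t T2t.
suff : - (u T2 ^+ 2) <= - (u t ^+ 2) by rewrite lerN2.
apply: (derive_ge0_le (fun s => - (u s ^+ 2))
  (fun s => - (2 * (u s * (v s + b s * u s)))) _ _ T2t) => x /andP[h1 _];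
  move: h1; rewrite ge_max => /andP[Tx x0].
  by apply: is_deriveN; exact: (sqr_derive _ _ _ _ _ _ luv).
have [un0 h] := H x Tx.
have -> : - (2 * (u x * (v x + b x * u x))) = u x ^+ 2 * (2 * - (b x + v x / u x)).
  by field.
rewrite mulr_ge0 ?sqr_ge0// mulr_ge0// oppr_ge0 (le_trans h)// oppr_le0.
by rewrite mulr_ge0 ?sqrtr_ge0// divr_ge0// ltW.
Qed.

(** Once [u' / u >= 1], the derivative of [u^2] stays above the positive value [u T2 ^+ 2]; the
    resulting linear growth suffices. *)
Lemma dominant_unbounded u v : lin u v -> dominant u v ->
  forall T C, exists2 t, T <= t & C < u t ^+ 2.
Proof.
move=> luv [T' H] T C.
pose T2 := Num.max T (Num.max T' (Num.max 1 ((2 / k) ^+ 2))).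
have T2P x : T2 <= x -> [/\ T <= x, T' <= x, 1 <= x & 1 <= k / 2 * Num.sqrt x].
  rewrite !ge_max => /andP[h1 /andP[h2 /andP[h3 h4]]]; split=> //.
  have q0 : 0 <= 2 / k by rewrite divr_ge0// ltW.
  have : 2 / k <= Num.sqrt x by rewrite -(ger0_norm q0) -sqrtr_sqr ler_wsqrtr.
  by rewrite ler_pdivrMr// => h; lra.
have [_ T'2 T21 _] := T2P _ (lexx T2).
have [u20 _] := H _ T'2.
have A0 : 0 < u T2 ^+ 2 by rewrite exprn_even_gt0.
have dsq x : T2 <= x -> is_derive x 1 (fun s => u s ^+ 2) (2 * (u x * (v x + b x * u x))).
  move=> /T2P[_ _ x1 _]; apply: (sqr_derive _ _ _ _ _ _ luv); exact: le_trans x1.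
have dge x : T2 <= x -> 2 * u x ^+ 2 <= 2 * (u x * (v x + b x * u x)).
  move=> /T2P[_ T'x _ hx]; have [un0 h] := H x T'x.
  have -> : u x * (v x + b x * u x) = u x ^+ 2 * (b x + v x / u x) by field.
  by rewrite ler_pM2l// ler_peMr ?sqr_ge0// (le_trans hx).
have mono x : T2 <= x -> u T2 ^+ 2 <= u x ^+ 2.
  move=> T2x; apply: (derive_ge0_le (fun s => u s ^+ 2)
    (fun x => 2 * (u x * (v x + b x * u x))) _ _ T2x) => y /andP[h1 _].
    exact: dsq.
  by apply: le_trans (dge y h1); rewrite mulr_ge0 ?sqr_ge0.
pose t := T2 + (`|C| + 1) / u T2 ^+ 2.
have T2t : T2 <= t by rewrite lerDl divr_ge0 ?addr_ge0// ltW.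
exists t; first by have [] := T2P t T2t.
have : u T2 ^+ 2 - u T2 ^+ 2 * T2 <= u t ^+ 2 - u T2 ^+ 2 * t.
  apply: (derive_ge0_le (fun s => u s ^+ 2 - u T2 ^+ 2 * s)
    (fun x => 2 * (u x * (v x + b x * u x)) - u T2 ^+ 2 * 1) _ _ T2t) => x /andP[h1 _].
    exact: (derive1B _ _ _ _ _ (dsq x h1) (derive1cM _ _ _ _ (derive1id x))).
  rewrite mulr1 subr_ge0; apply: le_trans (dge x h1).
  by apply: (le_trans (mono x h1)); rewrite ler_peMl ?sqr_ge0// ler1n.
have -> : u T2 ^+ 2 * t = u T2 ^+ 2 * T2 + (`|C| + 1).
  by rewrite /t; field; exact: u20.
have := ler_norm C; lra.
Qed.

Lemma recessive_wron0 u v w z : lin u v -> lin w z -> recessive u v ->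
  recessive w z -> forall t, 0 <= t -> wron u v w z t = 0.
Proof.
move=> l1 l2 r1 r2 t t0; apply/eqP/negPn/negP => Wt.
have T10 := T1_ge0 T1 (lexx _).
have WT : wron u v w z T1 != 0 by rewrite (wron_cst b a (16 * k ^+ 2) u v w z T1 t).
(* This combination has first component 0 at [T1], and second component the Wronskian there, assumed
   nonzero. *)
pose x := - w T1; pose y := u T1.
have l3 := lin_comb _ _ _ x y _ _ _ _ l1 l2.
have n3 : nz (fun t => x * u t + y * w t) (fun t => x * v t + y * z t).
  apply: (lin_nz _ _ _ cb _ _ T1 l3 T10); apply/orP; right.
  by rewrite /x /y mulNr addrC.
have d3 : dominant (fun t => x * u t + y * w t) (fun t => x * v t + y * z t).
  by apply: (zero_dominant _ _ _ l3 n3 (lexx T1)); rewrite /x /y; ring.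
have [S1 [C1 h1]] := recessive_bounded _ _ l1 r1.
have [S2 [C2 h2]] := recessive_bounded _ _ l2 r2.
have [s] := dominant_unbounded _ _ l3 d3 (Num.max S1 S2)
  (2 * (x ^+ 2 * C1 + y ^+ 2 * C2)).
rewrite ge_max => /andP[/h1 s1 /h2 s2] /=; apply/negP; rewrite -leNgt.
have e1 : x ^+ 2 * u s ^+ 2 <= x ^+ 2 * C1 by rewrite ler_wpM2l ?sqr_ge0.
have e2 : y ^+ 2 * w s ^+ 2 <= y ^+ 2 * C2 by rewrite ler_wpM2l ?sqr_ge0.
(* The square of a sum is at most twice the sum of the squares, so the combination is bounded as
   well. *)
have := sqr_ge0 (x * u s - y * w s); rewrite sqrrB sqrrD !exprMn; lra.
Qed.

(** For each [n] some direction [th n] gives a solution whose first component vanishes at [T1 + n].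
    These angles cluster at some [p], and the solution of angle [p] satisfies [Q <= 0] at every time
    [T1 + n], so it cannot be dominant. *)
Lemma recessive_ex : exists u v, [/\ lin u v, nz u v & recessive u v].
Proof.
have T10 := T1_ge0 T1 (lexx _).
have [u [v [w [z [l1 l2 W]]]]] := lin_fundamental b a (16 * k ^+ 2) cb.
pose U th t : R := cos th * u t + sin th * w t.
pose V th t : R := cos th * v t + sin th * z t.
have lUV th : lin (U th) (V th) by exact: lin_comb.
have nUV th : nz (U th) (V th).
  apply: (lin_nz _ _ _ cb _ _ T1 (lUV th) T10).
  rewrite -negb_and; apply/negP => /andP[/eqP U0 /eqP V0].
  have := W T1 T10; rewrite /wron => W1.
  have c0 : cos th = 0.
    rewrite -[LHS]mulr1 -W1; transitivity (U th T1 * z T1 - V th T1 * w T1).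
      by rewrite /U /V; ring.
    by rewrite U0 V0 !mul0r subrr.
  have s0 : sin th = 0.
    rewrite -[LHS]mulr1 -W1; transitivity (V th T1 * u T1 - U th T1 * v T1).
      by rewrite /U /V; ring.
    by rewrite U0 V0 !mul0r subrr.
  have := cos2Dsin2 th; rewrite c0 s0 expr0n addr0 => /eqP.
  by rewrite eq_sym oner_eq0.
have /boolp.choice[th thP] : forall n : nat, exists th : R,
    0 <= th <= pi /\ U th (T1 + n%:R) = 0.
  move=> n; set t := T1 + n%:R.
  have t0 : 0 <= t by rewrite addr_ge0.
  have := W t t0; rewrite /wron => Wt.
  pose N := Num.sqrt (u t ^+ 2 + w t ^+ 2).
  have N2 : 0 < u t ^+ 2 + w t ^+ 2.
    rewrite lt_neqAle addr_ge0 ?sqr_ge0// andbT eq_sym paddr_eq0 ?sqr_ge0//.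
    rewrite !sqrf_eq0; apply/negP => /andP[/eqP u0 /eqP w0].
    by move/eqP : Wt; rewrite u0 w0 !mul0r subrr eq_sym oner_eq0.
  have N0 : 0 < N by rewrite sqrtr_gt0.
  have NN : N ^+ 2 = u t ^+ 2 + w t ^+ 2 by rewrite sqr_sqrtr// ltW.
  (* A direction matters only up to sign; choosing [y >= 0] places its angle in [[0, pi]], where
     [acos] recovers it. *)
  have [x [y [y0 xy1 xy0]]] : exists x y : R,
      [/\ 0 <= y, x ^+ 2 + y ^+ 2 = 1 & x * u t + y * w t = 0].
    have [u0|/ltW u0] := leP 0 (u t).
      exists (- w t / N), (u t / N); split; first by rewrite divr_ge0// ltW.
      - rewrite !exprMn sqrrN -mulrDl addrC exprVn -NN divff//.
        by rewrite expf_neq0// gt_eqF.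
      - by field; rewrite gt_eqF.
    exists (w t / N), (- u t / N); split.
    - by rewrite divr_ge0 ?oppr_ge0// ltW.
    - rewrite !exprMn sqrrN -mulrDl addrC exprVn -NN divff//.
      by rewrite expf_neq0// gt_eqF.
    - by field; rewrite gt_eqF.
  have x1 : -1 <= x <= 1.
    have x2 : x ^+ 2 <= 1 by have := sqr_ge0 y; lra.
    by apply/andP; split; nra.
  exists (acos x); split; first by rewrite acos_ge0// acos_lepi.
  rewrite /U acosK// sin_acos//.
  have -> : 1 - x ^+ 2 = y ^+ 2 by rewrite -xy1; ring.
  by rewrite sqrtr_sqr ger0_norm.
pose QQ s th := Q (U th) (V th) (-1) s.
have cQQ s : continuous (QQ s).
  have cU : continuous (fun th => U th s).
    by move=> x; apply: cvgD; apply: cvgMl; [exact: continuous_cos|exact: continuous_sin].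
  have cV : continuous (fun th => V th s).
    by move=> x; apply: cvgD; apply: cvgMl; [exact: continuous_cos|exact: continuous_sin].
  move=> x; apply: cvgM; first exact: cU.
  by apply: cvgB; [exact: cV|apply: cvgMr; exact: cU].
have [p [_ clp]] : `[(0:R), pi]%classic `&` cluster (th @ \oo) !=set0.
  apply: (@segment_compact R 0 pi (th @ \oo)).
  by exists 0%N => // n _ /=; rewrite in_itv/=; have [] := thP n.
have QQle (n : nat) : QQ (T1 + n%:R) p <= 0.
  rewrite leNgt; apply/negP => Qp.
  have /= nbh : \forall x \near p, 0 < QQ (T1 + n%:R) x.
    by apply: (cvgr_gt _ (cQQ (T1 + n%:R) p)).
  (* Some [th m] with [m >= n] lies where [Q] is positive at time [T1 + n]; as [Q] is nondecreasing
     in time, this contradicts its vanishing at [T1 + m]. *)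
  have ev : (th @ \oo) [set x | exists2 m : nat, (n <= m)%N & th m = x].
    by exists n => // m /= nm; exists m.
  have [x [[m nm <-] Qx]] := clp _ _ ev nbh.
  move: Qx => /=; rewrite ltNge => /negP; apply.
  have -> : 0 = QQ (T1 + m%:R) (th m) by rewrite /QQ /Q (thP m).2 mul0r.
  apply: barrier_cst => //.
  - by rewrite lerDl.
  - by rewrite lerD2l ler_nat.
  - by rewrite normrN normr1.
exists (U p), (V p); split=> //.
have [/dominant_Q[T HT]|//] := dominant_or_recessive _ _ (lUV p) (nUV p).
pose n := (Num.Def.trunc `|T|).+1.
suff Tn : T <= T1 + n%:R by have := HT _ Tn; rewrite ltNge (QQle n).
have : T <= n%:R by rewrite (le_trans (ler_norm T))//; apply/ltW/truncnS_gt.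
have := T1_ge1; lra.
Qed.

End Barriers.
End Asymptotics.

(** * Riccati paths as quotients of linear solutions *)

Section Representation.
Context {R : realType} (b : R -> R) (a c : R).
Hypothesis cb : continuous b.
Implicit Types (u v w z : R -> R) (s t x y : R) (Z : R -> \bar R).

Local Notation lin := (lin b a c).

(** The relation [ze = b t + v t / u t] without division. Both infinities correspond to [u t = 0],
    which covers the forward and the backward convention at a pole. *)
Definition rep u v t (ze : \bar R) : Prop :=
  match ze with r%:E => v t = (r - b t) * u t | _ => u t = 0 end.

Lemma rep_wron0 u v w z t ze : rep u v t ze -> rep w z t ze -> wron u v w z t = 0.
Proof. by rewrite /wron; case: ze => [r| |] /= -> ->; ring. Qed.

Lemma rep_transfer u v w z t ze : 0 <= t -> nz u v -> wron u v w z t = 0 ->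
  rep u v t ze -> rep w z t ze.
Proof.
move=> t0 nuv; have := nuv t t0; rewrite /wron => nuvt /eqP; rewrite subr_eq0 => /eqP W.
case: ze => [r| |] /= h.
- have un0 : u t != 0.
    by apply/eqP => u0; have := nuvt u0; rewrite h u0 mulr0 eqxx.
  by apply: (mulfI un0); rewrite W h; ring.
- move/eqP : W; rewrite h mul0r eq_sym mulf_eq0 (negbTE (nuvt h)) orbF.
  by move/eqP.
- move/eqP : W; rewrite h mul0r eq_sym mulf_eq0 (negbTE (nuvt h)) orbF.
  by move/eqP.
Qed.

Definition rep_near Z t := exists u v,
  [/\ lin u v, nz u v & \forall s \near t, rep u v s (Z s)].

(** With [Y = Z - b], both [v - Y u] and [z - Y w] solve [y' = - (Y + b) y], so their quotient is
    constant. It vanishes at [t], where [v = Y u], hence nearby. *)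
Lemma rep_near_fin Z t : 0 < t ->
  (\forall s \near t, Z s \is a fin_num /\
    is_derive s 1 (fun s => fine (Z s) - b s) (a + c * s - fine (Z s) ^+ 2)) ->
  rep_near Z t.
Proof.
move=> t0 H; pose Y s : R := fine (Z s) - b s.
have [u [v [l1 u1 v1]]] := lin_ex b a c cb t 1 (Y t) (ltW t0).
have [w [z [l2 w1 z1]]] := lin_ex b a c cb t 0 1 (ltW t0).
have n1 : nz u v by apply: (lin_nz _ _ _ cb _ _ _ l1 (ltW t0)); rewrite u1 oner_eq0.
exists u, v; split=> //.
pose D s : R := z s - Y s * w s; pose A s : R := v s - Y s * u s.
have [_ dYt] := nbhs_singleton H.
have [dwt dzt] := l2 t (ltW t0).
have cD : {for t, continuous D}.
  exact: derive1cont (derive1B _ _ _ _ _ dzt (derive1M _ _ _ _ _ dYt dwt)).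
have Dt : D t = 1 by rewrite /D w1 z1 mulr0 subr0.
have Dn0 : \forall s \near t, D s != 0.
  have D0 : 0 < D t by rewrite Dt.
  by near=> s; rewrite gt_eqF//; near: s; exact: (cvgr_gt _ cD).
have t0n : \forall s \near t, 0 <= s.
  by near=> s; apply: ltW; near: s; exact: lt_nbhsr.
have [d /= d0 Hd] : \forall s \near t, [/\ 0 <= s, D s != 0, Z s \is a fin_num &
    is_derive s 1 Y (a + c * s - fine (Z s) ^+ 2)].
  by near=> s; split; by [near: s | case: (near H s _)].
have dAD s : `|t - s| < d -> is_derive s 1 (fun s => A s / D s) 0.
  move=> ds; have [s0 Ds Zs dY] := Hd s ds.
  have [du dv] := l1 s s0; have [dw dz] := l2 s s0.
  have dA := derive1B _ _ _ _ _ dv (derive1M _ _ _ _ _ dY du).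
  have dD := derive1B _ _ _ _ _ dz (derive1M _ _ _ _ _ dY dw).
  apply: (is_derive_eq (derive1div _ _ _ _ _ Ds dA dD)).
  have -> : fine (Z s) = Y s + b s by rewrite /Y subrK.
  apply/eqP; rewrite mulf_eq0; apply/orP; left; apply/eqP.
  rewrite /A /D; ring.
have At : A t = 0 by rewrite /A u1 v1 mulr1 subrr.
exists d => //= s ds.
have [s0 Ds Zs dY] := Hd s ds.
suff As : A s = 0.
  by rewrite -(fineK Zs) /=; apply/eqP; rewrite -subr_eq0 -As.
have E : A s / D s = A t / D t.
  have [st|/ltW ts] := leP s t.
    have [|x _ E] := derive_MVT (fun s => A s / D s) (fun=> 0) s t st.
      move=> x /andP[sx xt]; apply: dAD; apply: le_lt_trans ds.
      by rewrite !ger0_norm ?subr_ge0// lerB.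
    by apply/esym/eqP; rewrite -subr_eq0 E mul0r.
  have [|x _ E] := derive_MVT (fun s => A s / D s) (fun=> 0) t s ts.
    move=> x /andP[tx xs]; apply: dAD; apply: le_lt_trans ds.
    by rewrite !ler0_norm ?subr_le0// lerN2 lerB.
  by apply/eqP; rewrite -subr_eq0 E mul0r.
by move/eqP : E; rewrite At mul0r mulf_eq0 invr_eq0 (negbTE Ds) orbF => /eqP.
Unshelve. all: by end_near. Qed.

(** Connectedness of an interval, obtained from the mean value theorem: the indicator function of
    [P] has derivative zero. *)
Lemma locally_constant (P : R -> Prop) x y :
  (forall t, x < t < y -> \forall s \near t, P s <-> P t) ->
  forall s t, x < s < y -> x < t < y -> P s -> P t.
Proof.
move=> H.
pose f t : R := if `[< P t >] then 1 else 0.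
have df t : x < t < y -> is_derive t 1 f 0.
  move=> /H Ht; apply/is_deriveP => e e0; apply: filterS Ht => s Pst.
  have -> : f s = f t by rewrite /f (asbool_equiv_eq Pst).
  by rewrite subrr mul0r subrr normr0 mulr_ge0// ltW.
suff feq s t : s <= t -> x < s < y -> x < t < y -> f s = f t.
  move=> s t xs xt Ps; have : f s = f t.
    by have [st|/ltW ts] := leP s t; [exact: feq|apply/esym/feq].
  rewrite /f asboolT//; case: asboolP => // _ /eqP.
  by rewrite oner_eq0.
move=> st /andP[xs _] /andP[_ ty].
have [|r _ E] := derive_MVT f (fun=> 0) s t st.
  by move=> r /andP[sr rt]; apply: df; rewrite (lt_le_trans xs)// (le_lt_trans rt).
by apply/esym/eqP; rewrite -subr_eq0 E mul0r.
Qed.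

(** Near each time some [(w, z)] represents the path; [(u, v)] represents it at a nearby time
    exactly when the constant Wronskian of the two vanishes. *)
Lemma rep_propagate Z u v x y s t : lin u v -> nz u v -> 0 <= x ->
  (forall t, x < t < y -> rep_near Z t) ->
  x < s < y -> x < t < y -> rep u v s (Z s) -> rep u v t (Z t).
Proof.
move=> l1 n1 x0 H xs xt.
apply: (locally_constant (fun t => rep u v t (Z t)) x y _ s t xs xt) => {s t xs xt} t xt.
have [w [z [l2 n2 Hwz]]] := H t xt.
have wt := nbhs_singleton Hwz.
have t0 : 0 < t by apply: le_lt_trans x0 _; case/andP: xt.
have key s r : 0 <= s -> 0 <= r -> rep w z s (Z s) -> rep w z r (Z r) ->
    rep u v s (Z s) -> rep u v r (Z r).
  move=> s0 r0 ws wr us; apply: (rep_transfer w z) => //.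
  rewrite (wron_cst b a c w z u v r s)//; exact: (rep_wron0 _ _ _ _ _ (Z s)).
near=> s.
have s0 : 0 <= s by apply: ltW; near: s; exact: lt_nbhsr.
have ws : rep w z s (Z s) by near: s.
by split; apply: key => //; exact: ltW.
Unshelve. all: by end_near. Qed.

(** If [u t] is nonzero, the quotient converges and limits are unique. If it is zero, only a finite
    [ze] needs an argument: the relation [v = (Z - b) u] passes to the limit. *)
Lemma rep_lim (F : set_system R) Z u v t ze : ProperFilter F ->
  u @ F --> u t -> v @ F --> v t -> b @ F --> b t -> Z @ F --> ze ->
  (\forall s \near F, rep u v s (Z s)) -> rep u v t ze.
Proof.
move=> PF cu cv cbt cZ H.
have [u0|u0] := eqVneq (u t) 0; last first.
  have un0 : \forall s \near F, u s != 0.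
    exact: (cvgr_neq0 _ cu).
  have HZ : \forall s \near F, Z s = (b s + v s / u s)%:E.
    near=> s; have us0 : u s != 0 by near: s.
    have : rep u v s (Z s) by near: s.
    case: (Z s) => [r /= ->| /= us | /= us]; last 2 first.
    - by rewrite us eqxx in us0.
    - by rewrite us eqxx in us0.
    by rewrite mulfK// addrC subrK.
  have cL : (fun s => (b s + v s / u s)%:E) @ F --> (b t + v t / u t)%:E.
    apply: cvg_EFin; first by near=> s.
    apply: cvgD => //; apply: cvgM => //; exact: cvgV.
  have cZ' : Z @ F --> (b t + v t / u t)%:E.
    apply: cvg_trans cL; apply: near_eq_cvg; apply: filterS HZ => s ->.
    by [].
  have -> : ze = (b t + v t / u t)%:E.
    exact: (cvg_unique (@ereal_hausdorff R) cZ cZ').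
  by rewrite /= addrAC subrr add0r divfK.
case: ze cZ => [r /fine_cvgP[Zf cZ]| |] //=.
have c0 : (fun s => v s - (fine (Z s) - b s) * u s) @ F --> v t - (r - b t) * u t.
  by apply: cvgB => //; apply: cvgM => //; apply: cvgB.
have c0' : (fun s => v s - (fine (Z s) - b s) * u s) @ F --> (0 : R).
  apply: cvg_near_cst; near=> s.
  have Zs : Z s \is a fin_num by near: s.
  have : rep u v s (Z s) by near: s.
  by rewrite -(fineK Zs) /= => ->; rewrite subrr.
by apply/eqP; rewrite -subr_eq0; apply/eqP; exact: (cvg_unique (@Rhausdorff R) c0 c0').
Unshelve. all: by end_near. Qed.

Lemma lin_cvg u v t : lin u v -> 0 <= t ->
  (u @ nbhs t --> u t) /\ (v @ nbhs t --> v t).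
Proof.
move=> l1 t0; have [du dv] := l1 t t0.
by split; [exact: derive1cont du|exact: derive1cont dv].
Qed.

Lemma rep_lim_right Z u v t ze : lin u v -> 0 <= t -> Z s @[s --> t^'+] --> ze ->
  (\forall s \near t^'+, rep u v s (Z s)) -> rep u v t ze.
Proof.
move=> l1 t0 cZ H; have [cu cv] := lin_cvg _ _ _ l1 t0.
apply: (rep_lim (t^'+) Z) => //; apply: cvg_at_right_filter => //; exact: cb.
Qed.

Lemma rep_lim_left Z u v t ze : lin u v -> 0 <= t -> Z s @[s --> t^'-] --> ze ->
  (\forall s \near t^'-, rep u v s (Z s)) -> rep u v t ze.
Proof.
move=> l1 t0 cZ H; have [cu cv] := lin_cvg _ _ _ l1 t0.
apply: (rep_lim (t^'-) Z) => //; apply: cvg_at_left_filter => //; exact: cb.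
Qed.

(** The common part of the forward and backward notions: which infinity is assigned at a pole is
    left open, and so is the behaviour at [t0]. *)
Definition riccati_path t0 Z :=
  (forall t, t0 < t -> Z t \is a fin_num ->
    (\forall s \near t, Z s \is a fin_num) /\
    is_derive t 1 (fun s => fine (Z s) - b s) (a + c * t - fine (Z t) ^+ 2)) /\
  (forall t, t0 < t -> Z t \isn't a fin_num ->
    Z s @[s --> t^'-] --> -oo%E /\ Z s @[s --> t^'+] --> +oo%E).

(** * Isolated poles, and a single linear solution for the whole path *)

Section Path.
Context (t0 : R) (Z : R -> \bar R).
Hypotheses (t00 : 0 <= t0) (pZ : riccati_path t0 Z).

Let rep_near_finZ t : t0 < t -> Z t \is a fin_num -> rep_near Z t.
Proof.
move=> t0t Zt; have [Zf _] := pZ.1 t t0t Zt.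
apply: rep_near_fin; first exact: le_lt_trans t0t.
near=> s; have Zs : Z s \is a fin_num by near: s.
split=> //; apply: (pZ.1 s _ Zs).2.
by near: s; exact: lt_nbhsr.
Unshelve. all: by end_near. Qed.

(** Just after [t] the path is positive, whereas it takes negative values just before any pole;
    hence there is no other pole there. *)
Let fin_right t : t0 <= t -> Z s @[s --> t^'+] --> +oo%E ->
  exists2 d, 0 < d & forall s, t < s < t + d -> Z s \is a fin_num.
Proof.
move=> t0t /cvgeyPgt/(_ 0)[d /= d0 Hd].
have pos s : t < s < t + d -> (0 < Z s)%E.
  move=> /andP[ts std]; apply: Hd => //=.
  by rewrite ltr0_norm ?subr_lt0// opprB ltrBlDl.
exists d => // s std; apply/negPn/negP => Zs.
have /andP[ts sd] := std.
have [/cvgeNyPlt/(_ 0) neg _] := pZ.2 s (le_lt_trans t0t ts) Zs.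
have [r [/= rneg tr rs]] : exists r, [/\ (Z r < 0)%E, t < r & r < s].
  near s^'- => r; exists r; split; first by near: r.
  - by near: r; exact: nbhs_left_gt.
  - by near: r; exact: nbhs_left_lt.
by have := pos r; rewrite tr (lt_trans rs sd) => /(_ isT); rewrite ltNge (ltW rneg).
Unshelve. all: by end_near. Qed.

Let fin_left t : t0 < t -> Z s @[s --> t^'-] --> -oo%E ->
  exists2 d, 0 < d & forall s, t - d < s < t -> t0 < s /\ Z s \is a fin_num.
Proof.
move=> t0t /cvgeNyPlt/(_ 0)[d' /= d'0 Hd].
pose d := Num.min d' (t - t0).
have d0 : 0 < d by rewrite lt_min d'0 subr_gt0.
have neg s : t - d < s < t -> (Z s < 0)%E.
  move=> /andP[ts std]; apply: Hd => //=.
  rewrite gtr0_norm ?subr_gt0// ltrBlDl -ltrBlDr (le_lt_trans _ ts)//.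
  by rewrite lerB// ge_min lexx.
exists d => // s std; have /andP[ts sd] := std.
have t0s : t0 < s.
  apply: le_lt_trans ts; rewrite lerBrDl -lerBrDr.
  by rewrite ge_min lexx orbT.
split=> //; apply/negPn/negP => Zs.
have [_ /cvgeyPgt/(_ 0) pos] := pZ.2 s t0s Zs.
have [r [/= rpos sr rt]] : exists r, [/\ (0 < Z r)%E, s < r & r < t].
  near s^'+ => r; exists r; split; first by near: r.
  - by near: r; exact: nbhs_right_gt.
  - by near: r; exact: nbhs_right_lt.
by have := neg r; rewrite rt (lt_trans ts sr) => /(_ isT); rewrite ltNge (ltW rpos).
Unshelve. all: by end_near. Qed.

Let rep_itv x y : t0 <= x -> x < y ->
  (forall s, x < s < y -> Z s \is a fin_num) ->
  exists u v, [/\ lin u v, nz u v & forall s, x < s < y -> rep u v s (Z s)].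
Proof.
move=> t0x xy H; pose m := (x + y) / 2.
have xm : x < m < y by rewrite midf_lt//=; rewrite /m; lra.
have rn t : x < t < y -> rep_near Z t.
  move=> xt; apply: rep_near_finZ; last exact: H.
  by rewrite (le_lt_trans t0x)//; case/andP: xt.
have [u [v [l1 n1 /nbhs_singleton Hm]]] := rn m xm.
exists u, v; split=> // s xs.
exact: (rep_propagate Z u v x y m s l1 n1 (le_trans t00 t0x) rn xm xs Hm).
Qed.

(** At a pole, the linear solutions representing the path on either side both have first component
    0. Their Wronskian vanishes, and the one from the right also represents the path on the left. *)
Lemma path_rep_near t : t0 < t -> rep_near Z t.
Proof.
move=> t0t; have [/rep_near_finZ|Zt] := boolP (Z t \is a fin_num); first exact.
have tt0 : 0 <= t by rewrite (le_trans t00)// ltW.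
have [cl cr] := pZ.2 t t0t Zt.
have [d d0 Hd] := fin_right t (ltW t0t) cr.
have [e e0 He] := fin_left t t0t cl.
have [||u [v [l1 n1 Hu]]] := rep_itv t (t + d) (ltW t0t).
- by rewrite ltrDl.
- exact: Hd.
have [|||w [z [l2 n2 Hw]]] := rep_itv (Num.max (t - e) t0) t.
- by rewrite le_max lexx orbT.
- by rewrite gt_max t0t andbT ltrBlDr ltrDl.
- by move=> s; rewrite gt_max => /andP[/andP[h1 _] h2]; apply: (He s _).2; rewrite h1.
have ut : rep u v t +oo%E.
  apply: (rep_lim_right Z u v t +oo%E l1 tt0 cr); near=> s; apply: Hu.
  by apply/andP; split; near: s; [exact: nbhs_right_gt|
    apply: nbhs_right_lt; rewrite ltrDl].
have wt : rep w z t -oo%E.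
  apply: (rep_lim_left Z w z t -oo%E l2 tt0 cl); near=> s; apply: Hw.
  apply/andP; split; near: s; [apply: nbhs_left_gt|exact: nbhs_left_lt].
  by rewrite gt_max t0t andbT ltrBlDr ltrDl.
have W s : 0 <= s -> wron w z u v s = 0.
  move=> s0; rewrite (wron_cst b a c w z u v s t)//.
  exact: (rep_wron0 _ _ _ _ _ -oo%E).
exists u, v; split=> //; near=> s.
have [st|ts|<-] := ltgtP t s; last by move: Zt; case: (Z t).
  by apply: Hu; rewrite st/=; near: s; apply: lt_nbhsl; rewrite ltrDl.
have s0 : t0 < s by near: s; exact: lt_nbhsr.
have s0' : 0 <= s by rewrite (le_trans t00)// ltW.
apply: (rep_transfer w z) => //; first exact: W.
apply: Hw; rewrite ts andbT; near: s; apply: lt_nbhsr.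
by rewrite gt_max t0t andbT ltrBlDr ltrDl.
Unshelve. all: by end_near. Qed.

(** The initial datum is the right limit [ze] and not [Z t0]: a backward path with a pole at time 0
    has value [-oo] but right limit [+oo]. *)
Lemma path_rep ze : ze != -oo%E -> Z s @[s --> t0^'+] --> ze ->
  exists u v, [/\ lin u v, nz u v, rep u v t0 ze &
    forall t, t0 < t -> rep u v t (Z t)].
Proof.
move=> zeN cZ.
have [d d0 Hd] : exists2 d, 0 < d & forall s, t0 < s < t0 + d -> Z s \is a fin_num.
  case: ze zeN cZ => [r _ /fine_cvgP[+ _]|_|//]; last exact: fin_right.
  move=> [d /= d0 Hd]; exists d => // s /andP[ts std].
  by apply: Hd => //=; rewrite ltr0_norm ?subr_lt0// opprB ltrBlDl.
have [||u [v [l1 n1 Hu]]] := rep_itv t0 (t0 + d) (lexx _).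
- by rewrite ltrDl.
- exact: Hd.
exists u, v; split=> //.
  apply: (rep_lim_right Z u v t0 ze l1 t00 cZ); near=> s; apply: Hu.
  by apply/andP; split; near: s; [exact: nbhs_right_gt|
    apply: nbhs_right_lt; rewrite ltrDl].
move=> t t0t; pose m := t0 + d / 2.
have m0 : t0 < m < t0 + d by rewrite /m; apply/andP; split; lra.
pose y := Num.max t m + 1.
apply: (rep_propagate Z u v t0 y m t l1 n1 t00).
- by move=> s /andP[ts _]; exact: path_rep_near.
- by case/andP: m0 => -> _ /=; rewrite ltr_pwDr// le_max lexx orbT.
- by rewrite t0t /= ltr_pwDr// le_max lexx.
- exact: Hu.
Unshelve. all: by end_near. Qed.

End Path.

(** * From linear solutions back to Riccati paths *)

Section Quotient.
Context (u v : R -> R) (pole : \bar R).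
Hypotheses (luv : lin u v) (nuv : nz u v).

(** The value [pole] is [+oo] for forward solutions and [-oo] for backward ones. *)
Definition quot t : \bar R := if u t == 0 then pole else (b t + v t / u t)%:E.

Lemma quot_fin t r : 0 <= t -> pole \isn't a fin_num -> quot t = r%:E ->
  (\forall s \near t, quot s \is a fin_num) /\
  is_derive t 1 (fun s => fine (quot s) - b s) (a + c * t - r ^+ 2).
Proof.
move=> t0 polei; rewrite {1}/quot; case: ifPn => [_ pr|un0 [<-]].
  by rewrite pr in polei.
have [du dv] := luv t t0.
have un : \forall s \near t, u s != 0.
  exact: (cvgr_neq0 _ (derive1cont _ _ _ du)).
split; first by near=> s; rewrite /quot ifN//; near: s.
apply: (@is_derive_near _ (fun s => v s / u s)).
  near=> s; rewrite /quot ifN/=; last by near: s.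
  by rewrite addrAC subrr add0r.
apply: (is_derive_eq (derive1div _ _ _ _ _ un0 dv du)).
by field.
Unshelve. all: by end_near. Qed.

Lemma quot_cvg t : 0 <= t -> u t != 0 -> quot @ nbhs t --> quot t.
Proof.
move=> t0 un0; have [du dv] := luv t t0.
have un : \forall s \near t, u s != 0.
  exact: (cvgr_neq0 _ (derive1cont _ _ _ du)).
have -> : quot t = (b t + v t / u t)%:E by rewrite /quot ifN.
apply: cvg_trans (_ : (fun s => (b s + v s / u s)%:E) @ nbhs t --> _).
  apply: near_eq_cvg; near=> s; rewrite /quot ifN//; by near: s.
apply: cvg_EFin; first by near=> s.
apply: cvgD; first exact: cb.
apply: cvgM; first exact: (derive1cont _ _ _ dv).
by apply: cvgV => //; exact: (derive1cont _ _ _ du).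
Unshelve. all: by end_near. Qed.

(** At a zero of [u] one has [u' = v], so [u / v] has derivative 1: it crosses zero upwards, which
    fixes the signs of the explosion and of the restart. *)
Let pole_ratio t : 0 <= t -> u t = 0 ->
  \forall s \near t, v s != 0 /\ `|u s / v s - (s - t)| <= 1 / 2 * `|s - t|.
Proof.
move=> t0 ut; have vt := nuv t t0 ut; have [du dv] := luv t t0.
have dp : is_derive t 1 (fun s => u s / v s) 1.
  apply: (is_derive_eq (derive1div _ _ _ _ _ vt du dv)).
  by rewrite ut; field.
have half0 : 0 < 1 / 2 :> R by rewrite divr_gt0.
have := (is_deriveP _ _ _).1 dp (1 / 2) half0.
rewrite ut mul0r; move=> H.
have vn : \forall s \near t, v s != 0.
  exact: (cvgr_neq0 _ (derive1cont _ _ _ dv)).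
by apply: filterS2 H vn => s; rewrite subr0 mul1r => h1 h2.
Qed.

Let b_near t : \forall s \near t, `|b s - b t| <= 1.
Proof.
have /cvgrPdist_le/(_ 1 ltr01) := cb t.
by apply: filterS => s; rewrite distrC.
Qed.

Lemma quot_pole_right t : 0 <= t -> u t = 0 -> quot s @[s --> t^'+] --> +oo%E.
Proof.
move=> t0 ut; apply/cvgeyPge => A.
(* The inner unit absorbs the variation of [b] near [t], the outer one makes [M] positive. For
   [s - t < (2 * M)^-1], the ratio [u / v] is at most [3/2 (s - t)], hence below [1 / M]. *)
pose M : R := `|A - b t + 1| + 1.
have M0 : 0 < M by rewrite ltr_wpDl.
near=> s.
have st : t < s by near: s; exact: nbhs_right_gt.
have [vs hp] : v s != 0 /\ `|u s / v s - (s - t)| <= 1 / 2 * `|s - t|.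
  near: s; apply: cvg_within; exact: pole_ratio.
have hb : `|b s - b t| <= 1 by near: s; apply: cvg_within; exact: b_near.
have sM : s < t + (2 * M)^-1.
  by near: s; apply: nbhs_right_lt; rewrite ltrDl invr_gt0 mulr_gt0.
have e1 : `|s - t| = s - t by rewrite gtr0_norm ?subr_gt0.
rewrite {}e1 in hp.
move: hp; rewrite ler_norml => /andP[p1 p2].
have pp : 0 < u s / v s by lra.
have pM : u s / v s <= M^-1.
  have -> : M^-1 = 2 * (2 * M)^-1 by field; rewrite gt_eqF.
  lra.
have us : u s != 0 by apply/eqP => us; rewrite us mul0r ltxx in pp.
rewrite /quot ifN// lee_fin.
have -> : v s / u s = (u s / v s)^-1 by rewrite invfM invrK mulrC.
have : M <= (u s / v s)^-1.
  by rewrite -[M]invrK lef_pV2 ?posrE ?invr_gt0.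
move: hb; rewrite ler_norml => /andP[h1 _].
have := ler_norm (A - b t + 1).
rewrite /M; lra.
Unshelve. all: by end_near. Qed.

Lemma quot_pole_left t : 0 <= t -> u t = 0 -> quot s @[s --> t^'-] --> -oo%E.
Proof.
move=> t0 ut; apply/cvgeNyPle => A.
pose M : R := `|A - b t - 1| + 1.
have M0 : 0 < M by rewrite ltr_wpDl.
near=> s.
have st : s < t by near: s; exact: nbhs_left_lt.
have [vs hp] : v s != 0 /\ `|u s / v s - (s - t)| <= 1 / 2 * `|s - t|.
  near: s; apply: cvg_within; exact: pole_ratio.
have hb : `|b s - b t| <= 1 by near: s; apply: cvg_within; exact: b_near.
have sM : t - (2 * M)^-1 < s.
  by near: s; apply: nbhs_left_gt; rewrite ltrBlDr ltrDl invr_gt0 mulr_gt0.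
have e1 : `|s - t| = - (s - t) by rewrite ltr0_norm ?subr_lt0.
rewrite {}e1 in hp.
move: hp; rewrite ler_norml => /andP[p1 p2].
have pp : 0 < - (u s / v s) by lra.
have pM : - (u s / v s) <= M^-1.
  have -> : M^-1 = 2 * (2 * M)^-1 by field; rewrite gt_eqF.
  lra.
have us : u s != 0 by apply/eqP => us; rewrite us mul0r oppr0 ltxx in pp.
rewrite /quot ifN// lee_fin.
have -> : v s / u s = - (- (u s / v s))^-1 by rewrite invrN opprK invfM invrK mulrC.
have : M <= (- (u s / v s))^-1.
  by rewrite -[M]invrK lef_pV2 ?posrE ?invr_gt0.
move: hb; rewrite ler_norml => /andP[_ h1].
have := ler_norm (- (A - b t - 1)); rewrite normrN.
rewrite /M; lra.
Unshelve. all: by end_near. Qed.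

End Quotient.
End Representation.

(** * Oscillation of Brownian paths *)

Section NormalTail.
Context {R : realType}.

(** For [e = 1] or [e = -1] and [m < e * x], one has [x^2 >= (x - e m)^2 + m^2]: the density is at
    most [E] times the normal density centred at [e * m], whose total mass is 1. *)
Lemma normal_tail (s m : R) : 0 < s -> 0 <= m ->
  (normal_prob 0 s [set x : R | (m < `|x|)%R] <=
   (2 * expR (- m ^+ 2 / (s ^+ 2 *+ 2)))%:E)%E.
Proof.
move=> s0 m0; have sn0 : s != 0 by rewrite gt_eqF.
set E := expR _.
have pdf_le (e x : R) : e ^+ 2 = 1 -> m < e * x ->
    normal_pdf 0 s x <= E * normal_pdf (e * m) s x.
  move=> e2 mx; rewrite !normal_pdfE// mulrCA ler_wpM2l ?normal_peak_ge0//.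
  rewrite /normal_fun /E -expRD ler_expR -mulrDl ler_wpM2r//.
    by rewrite invr_ge0 mulrn_wge0// sqr_ge0.
  rewrite subr0 sqrrB exprMn e2 mul1r.
  have : m * m <= m * (e * x) by rewrite ler_wpM2l// ltW.
  rewrite -!expr2; nra.
have mA (e : R) : measurable [set x : R | (m < e * x)%R].
  have mf : measurable_fun setT (fun x : R => e * x).
    by apply: measurable_funM => //; exact: measurable_cst.
  have := measurable_fun_ltr (measurable_cst m) mf.
  move=> /(_ measurableT [set true] I); rewrite setTI.
  by rewrite [X in measurable X -> _](_ : _ = [set x : R | (m < e * x)%R]).
have half (e : R) : e ^+ 2 = 1 ->
    (normal_prob 0 s [set x : R | (m < e * x)%R] <= E%:E)%E.
  move=> e2; have mAe := mA e.
  rewrite /normal_prob.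
  apply: (@le_trans _ _ (\int[lebesgue_measure]_(x in [set x : R | (m < e * x)%R])
      (E%:E * (normal_pdf (e * m) s x)%:E))%E).
    apply: ge0_le_integral => //.
    - by move=> x _; rewrite lee_fin normal_pdf_ge0.
    - by apply/measurable_EFinP; apply: measurable_funTS; exact: measurable_normal_pdf.
    - apply/measurable_EFinP; apply: measurable_funTS; apply: measurable_funM => //.
      exact: measurable_normal_pdf.
    - by move=> x /= mx; rewrite -EFinM lee_fin pdf_le.
  rewrite ge0_integralZl//; first last.
  - by rewrite lee_fin expR_ge0.
  - by move=> x _; rewrite lee_fin normal_pdf_ge0.
  - by apply/measurable_EFinP; apply: measurable_funTS; exact: measurable_normal_pdf.
  rewrite -[leRHS]mule1; apply: lee_wpmul2l; first by rewrite lee_fin expR_ge0.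
  rewrite -(integral_normal_pdf (e * m) s).
  apply: ge0_subset_integral => //.
  - by apply/measurable_EFinP; exact: measurable_normal_pdf.
  - by move=> x _; rewrite lee_fin normal_pdf_ge0.
have setE : [set x : R | (m < `|x|)%R] =
    [set x : R | (m < 1 * x)%R] `|` [set x : R | (m < -1 * x)%R].
  apply/seteqP; split=> x /=; rewrite mul1r mulN1r.
    by case: (ger0P x) => _ ?; [left|right].
  by case=> /lt_le_trans; apply; [exact: ler_norm|rewrite -normrN ler_norm].
rewrite setE (_ : (2 * E)%:E = (E%:E + E%:E)%E); last first.
  by rewrite -EFinD; congr EFin; ring.
apply: (le_trans (measureU2 (normal_prob 0 s : {measure set _ -> \bar _}) (mA _) (mA _))).
by apply: leeD; apply: half; rewrite ?sqrrN expr1n.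
Qed.

End NormalTail.

(** * Chaining along dyadic points *)

Section Chaining.
Context {R : realType}.

(** The bound is the partial sum of the geometric series of ratio 3/4: an odd point of level [k + 1]
    is one step away from a point of level [k], and an even one is such a point. *)
Lemma chaining_dyadic (f : R -> R) (x0 th : R) :
  (forall k j : nat, (j < 2 ^ k)%N ->
    `|f (x0 + j.+1%:R / 2 ^+ k) - f (x0 + j%:R / 2 ^+ k)| <= th * (3 / 4) ^+ k) ->
  forall k j : nat, (j <= 2 ^ k)%N ->
    `|f (x0 + j%:R / 2 ^+ k) - f x0| <= 4 * th * (1 - (3 / 4) ^+ k.+1).
Proof.
move=> H.
have th0 : 0 <= th by have := H 0%N 0%N isT; rewrite expr0 mulr1; apply: le_trans.
elim=> [|k IH] j jk.
  have [->|j0] := posnP j.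
    by rewrite mul0r addr0 subrr normr0 mulr_ge0 ?mulr_ge0//; lra.
  have -> : j = 1%N by apply/eqP; rewrite eqn_leq jk.
  have := H 0%N 0%N isT; rewrite !expr0 expr1 divr1 mul0r addr0; lra.
have half i : (i.*2)%:R / 2 ^+ k.+1 = i%:R / 2 ^+ k :> R.
  by rewrite -muln2 natrM exprS; field; rewrite expf_neq0.
have pk : 0 <= (3 / 4) ^+ k.+1 :> R by rewrite exprn_ge0// divr_ge0.
have e : (3 / 4) ^+ k.+2 = 3 / 4 * (3 / 4) ^+ k.+1 :> R by rewrite exprS.
have tp : 0 <= th * (3 / 4) ^+ k.+1 by rewrite mulr_ge0.
have jE := odd_double_half j.
case: (boolP (odd j)) jE => [oj|oj] /= jE.
  have jk' : (j./2 < 2 ^ k)%N.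
    rewrite -ltn_double -[X in (_ < X)%N]mul2n -expnS; apply: leq_trans jk.
    by rewrite -[X in (_ <= X)%N]jE.
  have h1 := IH _ (ltnW jk').
  have := H k.+1 (j./2).*2; rewrite half.
  have -> : ((j./2).*2 < 2 ^ k.+1)%N by rewrite expnS mul2n ltn_double.
  move=> /(_ isT); rewrite -[X in X%:R / _]/(1 + (j./2).*2)%N jE => h2.
  have := ler_distD (f (x0 + (j./2)%:R / 2 ^+ k)) (f (x0 + j%:R / 2 ^+ k.+1)) (f x0).
  rewrite e; lra.
rewrite -jE add0n half.
have jk' : (j./2 <= 2 ^ k)%N.
  by rewrite -leq_double -[X in (_ <= X)%N]mul2n -expnS -[X in (X <= _)%N]add0n jE.
apply: (le_trans (IH _ jk')); rewrite e; lra.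
Qed.

Lemma chaining (f : R -> R) (x0 th : R) : continuous f ->
  (forall k j : nat, (j < 2 ^ k)%N ->
    `|f (x0 + j.+1%:R / 2 ^+ k) - f (x0 + j%:R / 2 ^+ k)| <= th * (3 / 4) ^+ k) ->
  forall s, x0 <= s <= x0 + 1 -> `|f s - f x0| <= 4 * th.
Proof.
move=> cf H s /andP[xs sx].
have th0 : 0 <= th by have := H 0%N 0%N isT; rewrite expr0 mulr1; apply: le_trans.
apply/ler_addgt0Pr => e e0.
have /cvgrPdist_le/(_ e e0)[d /= d0 Hd] := cf s.
have d20 : 0 < d / 2 by rewrite divr_gt0.
have [k hk] := div_expr2_le 1 (d / 2) d20.
have p2 : 0 < 2 ^+ k :> R by rewrite exprn_gt0.
pose y : R := (s - x0) * 2 ^+ k.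
have y0 : 0 <= y by rewrite mulr_ge0 ?subr_ge0// ltW.
pose j := Num.Def.trunc y.
have /andP[j1 j2] := truncn_itv y0.
have jk : (j <= 2 ^ k)%N.
  rewrite -(ler_nat R) natrX (le_trans j1)// /y ler_piMl ?(ltW p2)//; lra.
have h1 := chaining_dyadic f x0 th H k j jk.
have dist : `|s - (x0 + j%:R / 2 ^+ k)| < d.
  have -> : s - (x0 + j%:R / 2 ^+ k) = (y - j%:R) / 2 ^+ k.
    by rewrite /y; field; rewrite gt_eqF.
  rewrite ger0_norm; last by rewrite divr_ge0 ?subr_ge0// ltW.
  apply: (@le_lt_trans _ _ (1 / 2 ^+ k)); last by lra.
  rewrite ler_wpM2r ?invr_ge0 ?(ltW p2)// lerBlDr.
  by apply: ltW; rewrite addrC -natr1 in j2 *.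
have h2 := Hd _ dist.
have pk : 0 <= (3 / 4) ^+ k.+1 :> R by rewrite exprn_ge0// divr_ge0.
have := mulr_ge0 th0 pk.
have := ler_distD (f (x0 + j%:R / 2 ^+ k)) (f s) (f x0).
lra.
Qed.

End Chaining.

(** * Tails of the dyadic increments and the Borel-Cantelli argument *)

Section Oscillation.
Context {R : realType} {d : measure_display} {T : measurableType d}.
Context (P : probability T R) (B : T -> R -> R).
Hypothesis HB : is_std_brownian P B.

Let mincr (s t m : R) : 0 <= s -> 0 <= t ->
  measurable [set w | (m < `|B w t - B w s|)%R].
Proof.
move=> s0 t0; have [_ _ mB _] := HB.
have mf : measurable_fun setT (fun w => `|B w t - B w s|).
  by apply: measurableT_comp => //; apply: measurable_funB; exact: mB.
have := measurable_fun_ltr (measurable_cst m) mf.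
move=> /(_ measurableT [set true] I); rewrite setTI.
by rewrite [X in measurable X -> _](_ : _ = [set w | (m < `|B w t - B w s|)%R]).
Qed.

Lemma increment_tail (s t m : R) : 0 <= s -> s < t -> 0 <= m ->
  (P [set w | (m < `|B w t - B w s|)%R] <=
   (2 * expR (- m ^+ 2 / ((t - s) *+ 2)))%:E)%E.
Proof.
move=> s0 st m0; have [_ _ _ H] := HB.
pose ts (i : nat) := if i == 0%N then s else t.
pose A (i : nat) := [set x : R | (m < `|x|)%R].
have mA : measurable [set x : R | (m < `|x|)%R].
  have mf : measurable_fun setT (fun x : R => `|x|) by exact: measurableT_comp.
  have := measurable_fun_ltr (measurable_cst m) mf.
  move=> /(_ measurableT [set true] I); rewrite setTI.
  by rewrite [X in measurable X -> _](_ : _ = [set x : R | (m < `|x|)%R]).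
have := H 1%N ts A s0; rewrite big_ord1 /ts/=.
have -> : \bigcap_(i in `I_1) [set w | A i (B w t - B w (if i == 0%N then s else t))] =
    [set w | (m < `|B w t - B w s|)%R].
  apply/seteqP; split=> w /=; first by move=> /(_ 0%N isT).
  by move=> h i /=; rewrite ltnS leqn0 => /eqP ->.
move=> -> //; last by case.
apply: (le_trans (normal_tail _ m _ m0)); first by rewrite sqrtr_gt0 subr_gt0.
by rewrite sqr_sqrtr// subr_ge0 ltW.
Qed.

Lemma boole_le (A : nat -> set T) (n : nat) (e : R) :
  (forall i, (i < n)%N -> measurable (A i)) ->
  (forall i, (i < n)%N -> (P (A i) <= e%:E)%E) ->
  measurable (\big[setU/set0]_(i < n) A i) /\
  (P (\big[setU/set0]_(i < n) A i) <= (n%:R * e)%:E)%E.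
Proof.
elim: n => [|n IH] mA hA; first by rewrite big_ord0 measure0 mul0r.
have [i /ltnW hi|i /ltnW hi|m1 h1] := IH; [exact: mA|exact: hA|].
rewrite big_ord_recr/=; split; first by apply: measurableU => //; exact: mA.
apply: (le_trans (measureU2 P m1 (mA n (ltnSn n)))).
by rewrite -natr1 mulrDl mul1r EFinD; apply: leeD => //; exact: hA.
Qed.

Section Levels.
Variables (mu nu : R).
Hypotheses (mu0 : 0 < mu) (nu0 : 0 < nu) (nu1 : nu <= 1) (numu : nu <= mu ^+ 2 / 2).

Let thr (n : nat) : R := mu * Num.sqrt n.+1%:R + 6.

(** Since [(3/4)^2 * 2 = 9/8], the Gaussian exponent still grows with the level, by Bernoulli at
    least like [1 + k / 8]. The 6 in [thr] supplies [36 k / 16 >= 2 k], which covers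
    [nu * k + k]. *)
Let thr_exp (n k : nat) :
  nu * (n + k)%:R + k%:R <= (thr n * (3 / 4) ^+ k) ^+ 2 * 2 ^+ k / 2.
Proof.
have bern : 1 + k%:R / 8 <= (9 / 8) ^+ k :> R.
  elim: k => [|k IH]; first by rewrite expr0 mul0r addr0.
  rewrite exprS -natr1.
  have : 9 / 8 * (1 + k%:R / 8) <= 9 / 8 * (9 / 8) ^+ k :> R by rewrite ler_pM2l.
  by have : 0 <= k%:R :> R by []; lra.
have thr2 : mu ^+ 2 * n%:R + 36 <= thr n ^+ 2.
  have sn : Num.sqrt n.+1%:R ^+ 2 = n.+1%:R :> R by rewrite sqr_sqrtr.
  have s0 : 0 <= mu * Num.sqrt n.+1%:R by rewrite mulr_ge0 ?sqrtr_ge0// ltW.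
  rewrite /thr sqrrD exprMn sn -natr1.
  by have := sqr_ge0 mu; lra.
have -> : (thr n * (3 / 4) ^+ k) ^+ 2 * 2 ^+ k / 2 = thr n ^+ 2 * (9 / 8) ^+ k / 2.
  have -> : (9 / 8) ^+ k = ((3 / 4) ^+ k) ^+ 2 * 2 ^+ k :> R.
    by rewrite -exprM mulnC exprM -exprMn; congr (_ ^+ _); lra.
  by ring.
have : (mu ^+ 2 * n%:R + 36) * (1 + k%:R / 8) <= thr n ^+ 2 * (9 / 8) ^+ k.
  by apply: ler_pM => //; rewrite addr_ge0// mulr_ge0// sqr_ge0.
have n0 : 0 <= n%:R :> R by [].
have k0 : 0 <= k%:R :> R by [].
have : nu * n%:R <= mu ^+ 2 / 2 * n%:R by rewrite ler_wpM2r.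
have : nu * k%:R <= 1 * k%:R by rewrite ler_wpM2r.
have k8 : 0 <= k%:R / 8 :> R by rewrite divr_ge0.
have := mulr_ge0 (mulr_ge0 (sqr_ge0 mu) n0) k8.
rewrite natrD; lra.
Qed.

Let pt (n k j : nat) : R := n%:R + j%:R / 2 ^+ k.

Let ev (n k j : nat) :=
  [set w | (thr n * (3 / 4) ^+ k < `|B w (pt n k j.+1) - B w (pt n k j)|)%R].

Let pt_ge0 n k j : 0 <= pt n k j.
Proof. by rewrite /pt addr_ge0// divr_ge0// exprn_ge0. Qed.

Let ev_le (n k j : nat) :
  (P (ev n k j) <= (2 * expR (- (nu * (n + k)%:R + k%:R)))%:E)%E.
Proof.
have p2 : 0 < 2 ^+ k :> R by rewrite exprn_gt0.
have dpt : pt n k j.+1 - pt n k j = (2 ^+ k)^-1.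
  by rewrite /pt -natr1; field; rewrite gt_eqF.
have thr0 : 0 <= thr n * (3 / 4) ^+ k.
  rewrite mulr_ge0 ?exprn_ge0 ?divr_ge0// /thr addr_ge0// mulr_ge0 ?sqrtr_ge0//.
  exact: ltW.
apply: (le_trans (increment_tail _ _ _ (pt_ge0 n k j) _ thr0)).
  by rewrite -subr_gt0 dpt invr_gt0.
rewrite lee_fin ler_pM2l// ler_expR dpt.
have -> : - (thr n * (3 / 4) ^+ k) ^+ 2 / ((2 ^+ k)^-1 *+ 2) =
    - ((thr n * (3 / 4) ^+ k) ^+ 2 * 2 ^+ k / 2).
  by rewrite -mulr_natr; field; rewrite gt_eqF.
by rewrite lerN2; exact: thr_exp.
Qed.

(* Grouping the levels [k] of the intervals [[n, n + 1]] along the antidiagonals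
   [n + k = m] makes every union finite. *)
Let F (m : nat) := \big[setU/set0]_(k < m.+1)
  \big[setU/set0]_(j < 2 ^ k) ev (m - k) k j.

Let F_le m : measurable (F m) /\
  (P (F m) <= (m.+1%:R * (2 * expR (- (nu * m%:R))))%:E)%E.
Proof.
have inner (k : nat) : (k < m.+1)%N ->
    measurable (\big[setU/set0]_(j < 2 ^ k) ev (m - k) k j) /\
    (P (\big[setU/set0]_(j < 2 ^ k) ev (m - k) k j) <=
      (2 * expR (- (nu * m%:R)))%:E)%E.
  move=> km.
  have [i _|i _|mm hh] := boole_le (ev (m - k) k) (2 ^ k)
    (2 * expR (- (nu * ((m - k) + k)%:R + k%:R))).
  - exact: mincr.
  - exact: ev_le.
  split=> //; apply: (le_trans hh); rewrite lee_fin subnK//.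
  (* As [e >= 2], the factor [expR (- k)] compensates for the [2 ^ k] increments of level [k]. *)
  rewrite opprD expRD mulrCA ler_pM2l// mulrC -mulrA ler_piMr ?expR_ge0//.
  rewrite expRN mulrC ler_pdivrMr ?expR_gt0// mul1r natrX -[k%:R]mulr1.
  rewrite mulrC expRM_natr lerXn2r ?nnegrE ?expR_ge0//.
  by have := expR_ge1Dx (1 : R); lra.
have [i /inner[]|i /inner[]|mm hh] := boole_le
  (fun k => \big[setU/set0]_(j < 2 ^ k) ev (m - k) k j) m.+1
  (2 * expR (- (nu * m%:R))) => //.
Qed.

Let F_null : P (lim_sup_set F) = 0%E.
Proof.
apply: lim_sup_set_cvg0; first by move=> m; case: (F_le m).
(* The exponential is split into two factors [z ^+ m]: one absorbs the number [m + 1] of levels, the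
   other leaves a summable geometric series. *)
pose z := expR (- (nu / 2)).
have z0 : 0 < z by exact: expR_gt0.
have z1 : z < 1 by rewrite /z expR_lt1 oppr_lt0 divr_gt0.
have C0 : 0 <= 4 / nu by rewrite divr_ge0// ltW.
have Fgeo m : (P (F m) <= (geometric (4 / nu) z m)%:E)%E.
  apply: (le_trans (F_le m).2); rewrite lee_fin /=.
  have zm : z ^+ m = expR (- (nu / 2 * m%:R)).
    by rewrite /z -expRM_natr mulNr.
  have -> : expR (- (nu * m%:R)) = z ^+ m * z ^+ m.
    by rewrite zm -expRD; congr expR; field.
  rewrite mulrA mulrA ler_wpM2r ?exprn_ge0 ?(ltW z0)//.
  rewrite zm expRN ler_pdivrMr ?expR_gt0//.
  have := expR_ge1Dx (nu / 2 * m%:R).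
  move=> h; have : 4 / nu * (1 + nu / 2 * m%:R) <= 4 / nu * expR (nu / 2 * m%:R).
    by rewrite ler_wpM2l.
  apply: le_trans.
  have -> : 4 / nu * (1 + nu / 2 * m%:R) = 4 / nu + 2 * m%:R.
    by field; rewrite gt_eqF.
  have : 4 <= 4 / nu by rewrite ler_pdivlMr// ler_piMr.
  rewrite -natr1; lra.
apply: (@le_lt_trans _ _ (4 / nu / (1 - z))%:E); last exact: ltry.
apply: lime_le; first by apply: is_cvg_nneseries => n _ _; exact: measure_ge0.
apply: nearW => n.
apply: (@le_trans _ _ (\sum_(0 <= i < n) (geometric (4 / nu) z i)%:E)%E).
  by apply: lee_sum => i _; exact: Fgeo.
rewrite sumEFin lee_fin; apply: geometric_le_lim => //.
by rewrite gtr0_norm.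
Qed.

Lemma levels_event : exists E : set T, [/\ measurable E, P E = 1%E &
  forall w, E w -> exists M : nat, forall n k j : nat, (M <= n)%N -> (j < 2 ^ k)%N ->
   `|B w (n%:R + j.+1%:R / 2 ^+ k) - B w (n%:R + j%:R / 2 ^+ k)| <=
   (mu * Num.sqrt n.+1%:R + 6) * (3 / 4) ^+ k].
Proof.
have mF : measurable (lim_sup_set F).
  apply: bigcap_measurable => // n _; apply: bigcup_measurable => m _.
  by case: (F_le m).
exists (~` lim_sup_set F); split.
- exact: measurableC.
- by rewrite probability_setC// F_null sube0.
move=> w /= nF.
have [M HM] : exists M : nat, forall m, (M <= m)%N -> ~ F m w.
  apply: contrapT => /forallNP H; apply: nF => M _.
  have /existsNP[m] := H M; rewrite not_implyE => -[Mm /contrapT Fm].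
  by exists m.
exists M => n k j Mn jk; rewrite leNgt; apply/negP => h.
(* An excessive increment of level [k] in the interval starting at [n] lies in [F (n + k)], and
   [n + k >= M]: one [M] serves all levels. *)
apply: (HM (n + k)%N); first exact: leq_trans (leq_addr _ _).
have kn : (k < (n + k).+1)%N by rewrite ltnS leq_addl.
rewrite /F (bigD1 (Ordinal kn))//=; left.
rewrite (bigD1 (Ordinal jk))//=; left.
by rewrite /ev /= addnK.
Qed.

End Levels.

(** Freezing the path at its value at time 0 gives a function continuous on the whole line; for a
    Brownian path it is zero at negative times, as the averaging requires. *)
Definition extend0 (b : R -> R) (t : R) : R := b (Num.max t 0).

Lemma extend0_continuous w : continuous (extend0 (B w)).
Proof.
have [_ cB _ _] := HB; move=> t.
have t0 : (Num.max t 0 : R) \in `[0, +oo[%classic.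
  by rewrite inE/= in_itv/= andbT le_max lexx orbT.
have /subspace_continuousP/(_ (Num.max t 0)) := cB w.
move=> H.
have {}H : B w @ within `[0, +oo[%classic (nbhs (Num.max t 0)) --> B w (Num.max t 0).
  by apply: H; rewrite inE in t0.
move=> A /H HA.
have cm : (fun s : R => Num.max s 0) @ nbhs t --> Num.max t 0.
  apply: (@continuous_max R R (fun s => s) (fun=> 0)); first exact: cvg_id.
  exact: cvg_cst.
have HA' : nbhs t (fun s : R => `[0, +oo[%classic (Num.max s 0) ->
    A (B w (Num.max s 0))) := cm _ HA.
apply: (filterS _ HA') => s /=; apply.
by rewrite /= in_itv/= andbT le_max lexx orbT.
Qed.

Lemma brownian_oscillation (e : R) : 0 < e ->
  exists E : set T, [/\ measurable E, P E = 1%E & forall w, E w ->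
    exists T0, forall t s, T0 <= t -> t <= s <= t + 1 ->
      `|extend0 (B w) s - extend0 (B w) t| <= e * Num.sqrt t].
Proof.
(* The total is at most [16 (mu (r + 2) + 6)] with [r = sqrt t]. For [mu = e / 24] this is
   [2/3 e r + 4/3 e + 96], at most [e r] as soon as [r >= 4 + 288 / e], the value of [c] below. *)
move=> e0; pose mu := e / 24; pose nu := Num.min 1 (mu ^+ 2 / 2).
have mu0 : 0 < mu by rewrite divr_gt0.
have nu0 : 0 < nu by rewrite lt_min ltr01 divr_gt0// exprn_gt0.
have nu1 : nu <= 1 by rewrite ge_min lexx.
have numu : nu <= mu ^+ 2 / 2 by rewrite ge_min lexx orbT.
have [E [mE PE HE]] := levels_event mu nu mu0 nu0 nu1 numu.
exists E; split=> // w /HE[M HM].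
have cf := extend0_continuous w; set f := extend0 (B w) in cf *.
have fE x : 0 <= x -> f x = B w x by move=> x0; rewrite /f /extend0 max_l.
have block (n : nat) s : (M <= n)%N -> n%:R <= s <= n%:R + 1 ->
    `|f s - f n%:R| <= 4 * (mu * Num.sqrt n.+1%:R + 6).
  move=> Mn; apply: chaining => // k j jk.
  by rewrite !fE ?HM// addr_ge0// divr_ge0// exprn_ge0.
pose c := 4 + 288 / e.
have c0 : 0 <= c by rewrite addr_ge0// divr_ge0// ltW.
exists (Num.max M%:R (c ^+ 2)) => t s; rewrite ge_max => /andP[Mt ct] /andP[ts st].
have t0 : 0 <= t by rewrite (le_trans _ Mt).
have /andP[n1 n2] := truncn_itv t0; set n := Num.Def.trunc t in n1 n2.
have Mn : (M <= n)%N.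
  rewrite -ltnS -(ltr_nat R); exact: le_lt_trans n2.
have n2' : t <= n%:R + 1 by rewrite natr1 ltW.
pose r := Num.sqrt t.
have r2 : r ^+ 2 = t by rewrite sqr_sqrtr.
have r0 : 0 <= r by exact: sqrtr_ge0.
have cr : c <= r by rewrite -(ger0_norm c0) -sqrtr_sqr ler_wsqrtr.
have sq m : (m <= n.+2)%N -> Num.sqrt m%:R <= r + 2.
  move=> mn; have r20 : 0 <= r + 2 by rewrite addr_ge0.
  rewrite -(ger0_norm r20) -sqrtr_sqr ler_wsqrtr//.
  have : m%:R <= n.+2%:R :> R by rewrite ler_nat.
  rewrite -!natr1 sqrrD r2; lra.
have O1 := block n t Mn; rewrite n1 n2' in O1.
have O2 := block n (n%:R + 1) Mn; rewrite lerDl ler01 lexx in O2.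
have {}O1 := O1 isT; have {}O2 := O2 isT.
have q1 : mu * Num.sqrt n.+1%:R <= mu * (r + 2) by rewrite ler_wpM2l ?(ltW mu0)// sq.
have q2 : mu * Num.sqrt n.+2%:R <= mu * (r + 2) by rewrite ler_wpM2l ?(ltW mu0)// sq.
(* [s] may lie in the block of [t] or in the next one; in the first case the comparison goes through
   [n], at the cost of two block bounds. *)
have O3 : `|f s - f (n%:R + 1)| <= 8 * (mu * (r + 2) + 6).
  have [sn|/ltW sn] := leP s (n%:R + 1).
    have O4 := block n s Mn; rewrite sn (le_trans n1 ts) in O4.
    have {}O4 := O4 isT.
    have := ler_distD (f n%:R) (f s) (f (n%:R + 1)).
    rewrite [`|f n%:R - _|]distrC; lra.
  have O4 := block n.+1 s (leqW Mn); rewrite -natr1 sn in O4.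
  have : s <= n%:R + 1 + 1 by lra.
  move=> h; have {}O4 := O4 h.
  have : 0 <= mu * (r + 2) + 6 by rewrite addr_ge0// mulr_ge0 ?addr_ge0// ltW.
  lra.
have e1 := ler_distD (f (n%:R + 1)) (f s) (f t).
have e2 := ler_distD (f n%:R) (f (n%:R + 1)) (f t).
rewrite [`|f n%:R - f t|]distrC in e2.
have tot : `|f s - f t| <= 16 * (mu * (r + 2) + 6) by lra.
apply: (le_trans tot).
have ec : e * c <= e * r by rewrite ler_pM2l.
have ecE : e * c = 4 * e + 288 by rewrite /c; field; rewrite gt_eqF.
rewrite -/r /mu; lra.
Qed.

End Oscillation.

(** * Convergence and uniqueness *)

Section Solutions.
Context {R : realType} (b : R -> R) (beta a : R).
Implicit Types (u v : R -> R) (Z : R -> \bar R).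
Local Notation b' := (extend0 b).

Lemma extend0E (t : R) : 0 <= t -> extend0 b t = b t.
Proof. by move=> t0; rewrite /extend0 max_l. Qed.

Lemma near_extend0 (t : R) : 0 < t -> \forall s \near t, extend0 b s = b s.
Proof.
by move=> t0; near=> s; apply/extend0E/ltW; near: s; exact: lt_nbhsr.
Unshelve. all: by end_near. Qed.

Lemma is_derive_extend0 (f : R -> R) (t l : R) : 0 < t ->
  is_derive t 1 (fun s => f s - b s) l <-> is_derive t 1 (fun s => f s - b' s) l.
Proof.
move=> /near_extend0 H; split; apply: is_derive_near;
by apply: filterS H => s ->.
Qed.

Lemma forward_riccati t0 x0 Z : 0 <= t0 -> forward_sol b beta a t0 x0 Z ->
  riccati_path b' a (beta / 4) t0 Z.
Proof.
move=> t00 [_ _ ZN Zfin Zpole]; split=> t t0t Zt.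
  have tt0 : 0 < t by exact: le_lt_trans t0t.
  have [Zn dZ] := Zfin t (fine (Z t)) t0t (esym (fineK Zt)).
  split=> //; exact: ((is_derive_extend0 (fun s => fine (Z s)) t _ tt0).1 dZ).
apply: Zpole => //; have := ZN t (ltW t0t).
by move: Zt; case: (Z t).
Qed.

Lemma backward_riccati Z : backward_sol b beta a Z ->
  riccati_path b' a (beta / 4) 0 Z.
Proof.
move=> [_ Zy Zfin Zpole]; split=> t t0 Zt.
  have [Zn dZ] := Zfin t (fine (Z t)) t0 (esym (fineK Zt)).
  split=> //; exact: ((is_derive_extend0 (fun s => fine (Z s)) t _ t0).1 dZ).
have [|cr cl] := Zpole t t0; last by split.
by have := Zy t (ltW t0); move: Zt; case: (Z t).
Qed.

Hypothesis cb : continuous b'.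

Lemma quot_forward u v t0 : 0 <= t0 -> lin b' a (beta / 4) u v -> nz u v ->
  forward_sol b beta a t0 (quot b' u v +oo%E t0) (quot b' u v +oo%E).
Proof.
move=> t00 luv nuv; split=> //.
- have [u0|u0] := eqVneq (u t0) 0; last first.
    by apply: cvg_at_right_filter; exact: (quot_cvg _ _ _ cb _ _ _ luv).
  rewrite [X in _ --> X]/quot u0 eqxx.
  exact: (quot_pole_right _ _ _ cb _ _ _ luv nuv).
- by move=> t _; rewrite /quot; case: ifP.
- move=> t r t0t Zt; have tt0 : 0 < t by exact: le_lt_trans t0t.
  have [||h1 h2] := quot_fin _ _ _ _ _ +oo%E luv t r (ltW tt0) => //.
  split=> //; exact: ((is_derive_extend0 (fun s => fine (quot b' u v +oo%E s)) t _ tt0).2 h2).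
- move=> t t0t; rewrite {1}/quot; case: ifPn => // /eqP ut _.
  have tt0 : 0 <= t by rewrite (le_trans t00)// ltW.
  split; first exact: (quot_pole_left _ _ _ cb _ _ _ luv nuv).
  exact: (quot_pole_right _ _ _ cb _ _ _ luv nuv).
Qed.

Lemma quot_backward u v : lin b' a (beta / 4) u v -> nz u v ->
  backward_sol b beta a (quot b' u v -oo%E).
Proof.
move=> luv nuv; split=> //.
- have [u0|u0] := eqVneq (u 0) 0.
    right; split; first by rewrite /quot u0 eqxx.
    exact: (quot_pole_right _ _ _ cb _ _ _ luv nuv).
  left; exists (b' 0 + v 0 / u 0).
  have e : quot b' u v -oo%E 0 = (b' 0 + v 0 / u 0)%:E by rewrite /quot ifN.
  split=> //; rewrite -e.
  by apply: cvg_at_right_filter; exact: (quot_cvg _ _ _ cb _ _ _ luv).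
- by move=> t _; rewrite /quot; case: ifP.
- move=> t r tt0 Zt.
  have [||h1 h2] := quot_fin _ _ _ _ _ -oo%E luv t r (ltW tt0) => //.
  split=> //; exact: ((is_derive_extend0 (fun s => fine (quot b' u v -oo%E s)) t _ tt0).2 h2).
- move=> t tt0; rewrite {1}/quot; case: ifPn => // /eqP ut _.
  split; first exact: (quot_pole_right _ _ _ cb _ _ _ luv nuv _ (ltW tt0)).
  exact: (quot_pole_left _ _ _ cb _ _ _ luv nuv _ (ltW tt0)).
Qed.

End Solutions.

(** * Limits at infinity of the represented paths *)

Section Limits.
Context {R : realType} (b : R -> R) (k : R).
Hypothesis k0 : 0 < k.
Implicit Types (u v : R -> R) (Z : R -> \bar R).

Lemma rep_neq0 u v t ze : u t != 0 -> rep b u v t ze -> ze = (b t + v t / u t)%:E.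
Proof.
move=> u0; case: ze => [r /= ->|/= u00|/= u00].
- by rewrite mulfK// addrC subrK.
- by rewrite u00 eqxx in u0.
- by rewrite u00 eqxx in u0.
Qed.

Let sqrt_large (A : R) : \forall t \near +oo, A <= k / 2 * Num.sqrt t.
Proof.
near=> t.
have h : 0 <= `|A| / (k / 2) by rewrite !divr_ge0// ltW.
have : `|A| / (k / 2) <= Num.sqrt t.
  have h2 : (`|A| / (k / 2)) ^+ 2 <= t.
    by near: t; apply: nbhs_pinfty_ge; exact: num_real.
  by rewrite -[leLHS](ger0_norm h) -sqrtr_sqr ler_wsqrtr.
rewrite ler_pdivrMr ?divr_gt0// mulrC => /(le_trans (ler_norm A)).
by [].
Unshelve. all: by end_near. Qed.

Lemma dominant_cvg u v Z t0 : dominant b k u v ->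
  (forall t, t0 < t -> rep b u v t (Z t)) -> Z t @[t --> +oo] --> +oo%E.
Proof.
move=> [T HT] HZ; apply/cvgeyPge => A; near=> t.
have Tt : T <= t by near: t; apply: nbhs_pinfty_ge; exact: num_real.
have t0t : t0 < t by near: t; apply: nbhs_pinfty_gt; exact: num_real.
have [u0 h] := HT t Tt.
rewrite (rep_neq0 _ _ _ _ u0 (HZ t t0t)) lee_fin (le_trans _ h)//.
by near: t; exact: sqrt_large.
Unshelve. all: by end_near. Qed.

Lemma recessive_cvg u v Z t0 : recessive b k u v ->
  (forall t, t0 < t -> rep b u v t (Z t)) -> Z t @[t --> +oo] --> -oo%E.
Proof.
move=> [T HT] HZ; apply/cvgeNyPle => A; near=> t.
have Tt : T <= t by near: t; apply: nbhs_pinfty_ge; exact: num_real.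
have t0t : t0 < t by near: t; apply: nbhs_pinfty_gt; exact: num_real.
have [u0 h] := HT t Tt.
rewrite (rep_neq0 _ _ _ _ u0 (HZ t t0t)) lee_fin (le_trans h)// lerNl.
by near: t; exact: sqrt_large.
Unshelve. all: by end_near. Qed.

End Limits.

(** The only random input is the oscillation bound, whose constant depends on [beta] alone. Hence
    one event serves all [a], [t0] and [x0], and the rest is deterministic. *)
Theorem theorem3p2 (R : realType) (d : measure_display) (T : measurableType d)
  (P : probability T R) (beta : R) (B : T -> R -> R) :
  0 < beta -> is_std_brownian P B ->
  exists E : set T, [/\ measurable E, P E = 1%E &
    forall w, E w ->
      (forall (a t0 : R) (x0 : \bar R), 0 <= t0 -> x0 != -oo%E ->
         (exists Z, forward_sol (B w) beta a t0 x0 Z) /\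
         (forall Z, forward_sol (B w) beta a t0 x0 Z ->
            Z t @[t --> +oo] --> +oo%E \/ Z t @[t --> +oo] --> -oo%E)) /\
      (forall a : R,
         exists Zh, [/\ backward_sol (B w) beta a Zh,
           Zh t @[t --> +oo] --> -oo%E &
           forall Z, backward_sol (B w) beta a Z ->
             Z t @[t --> +oo] --> -oo%E ->
             forall t, 0 <= t -> Z t = Zh t])].
Proof.
move=> beta0 HB; pose k : R := Num.sqrt (beta / 4) / 4.
have c0 : 0 < beta / 4 by rewrite divr_gt0.
have k0 : 0 < k by rewrite divr_gt0// sqrtr_gt0.
have k2 : 16 * k ^+ 2 = beta / 4.
  by rewrite /k expr_div_n sqr_sqrtr ?(ltW c0)//; field.
have e0 : 0 < k / 2 by rewrite divr_gt0.
have [E [mE PE HE]] := brownian_oscillation P B HB _ e0.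
exists E; split=> // w /HE[T0 osc].
have [B0 _ _ _] := HB.
have cb := extend0_continuous P B HB w.
have b0 t : t <= 0 -> extend0 (B w) t = 0.
  by move=> t0; rewrite /extend0 max_r// B0.
set b' := extend0 (B w) in osc cb b0.
have [bt [dbt eta]] := averaged_ex b' k T0 cb b0 osc.
have dich a u v := dominant_or_recessive b' a k T0 k0 osc bt dbt eta u v.
rewrite k2 in dich.
split=> [a t0 x0 t00 x0N|a].
  split.
    have [u [v [luv nuv <-]]] : exists u v, [/\ lin b' a (beta / 4) u v, nz u v &
        quot b' u v +oo%E t0 = x0].
      case: x0 x0N => [r _|_|//].
        have [u [v [luv u1 v1]]] := lin_ex b' a (beta / 4) cb t0 1 (r - b' t0) t00.
        exists u, v; split=> //.
          by apply: (lin_nz _ _ _ cb _ _ _ luv t00); rewrite u1 oner_eq0.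
        by rewrite /quot u1 oner_eq0 v1 divr1 addrC subrK.
      have [u [v [luv u1 v1]]] := lin_ex b' a (beta / 4) cb t0 0 1 t00.
      exists u, v; split=> //.
        by apply: (lin_nz _ _ _ cb _ _ _ luv t00); rewrite v1 oner_eq0 orbT.
      by rewrite /quot u1 eqxx.
    by exists (quot b' u v +oo%E); exact: quot_forward.
  move=> Z fZ; have [_ cZ _ _ _] := fZ.
  have [u [v [luv nuv _ HZ]]] := path_rep b' a (beta / 4) cb t0 Z t00
    (forward_riccati _ _ _ _ _ _ t00 fZ) x0 x0N cZ.
  have [dom|rec] := dich a u v luv nuv.
    by left; exact: (dominant_cvg b' k k0 u v Z t0).
  by right; exact: (recessive_cvg b' k k0 u v Z t0).
have := recessive_ex b' a k T0 cb k0 osc bt dbt eta.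
rewrite k2 => -[u [v [luv nuv rec]]].
have quot_rep t : rep b' u v t (quot b' u v -oo%E t).
  rewrite /quot; have [u0|u0] := eqVneq (u t) 0; first by [].
  by rewrite /= addrAC subrr add0r divfK.
exists (quot b' u v -oo%E); split.
- exact: quot_backward.
- exact: (recessive_cvg b' k k0 u v _ 0).
move=> Z bZ ZN t tt0.
have [init Zy _ _] := bZ.
(* At time 0 the right limit [ze] may be [+oo] while the path has value [-oo]; both mean [u 0 = 0],
   so representations carry over. *)
have [ze [zeN cZ rep0]] : exists ze, [/\ ze != -oo%E, Z s @[s --> 0^'+] --> ze &
    forall u v, rep b' u v 0 ze -> rep b' u v 0 (Z 0)].
  by case: init => [[r [-> cr]]|[-> cr]]; [exists r%:E|exists +oo%E]; split.
have [w' [z [lwz nwz rz HZ]]] := path_rep b' a (beta / 4) cb 0 Z (lexx 0)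
  (backward_riccati _ _ _ _ bZ) ze zeN cZ.
have recwz : recessive b' k w' z.
  have [dom|//] := dich a w' z lwz nwz.
  have ZP := dominant_cvg b' k k0 w' z Z 0 dom HZ.
  by have : (-oo = +oo :> \bar R)%E by exact: (cvg_unique (@ereal_hausdorff R) ZN ZP).
have W : wron w' z u v t = 0.
  apply: (recessive_wron0 b' a k T0 cb k0 osc bt dbt eta w' z u v) => //;
  by rewrite k2.
have rwz : rep b' w' z t (Z t).
  by move: tt0; rewrite le_eqVlt => /predU1P[<-|/HZ//]; exact: rep0.
have := rep_transfer b' w' z u v t (Z t) tt0 nwz W rwz.
(* At a zero of [u] a finite value would force [v t = 0], and [+oo] is excluded for backward
   solutions; only [-oo] remains. *)
have [u0|u0] := eqVneq (u t) 0; last first.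
  by move=> /(rep_neq0 _ _ _ _ _ u0) ->; rewrite /quot ifN.
rewrite /quot u0 eqxx; have := Zy t tt0; case: (Z t) => //= r _.
by rewrite u0 mulr0 => v0; have := nuv t tt0 u0; rewrite v0 eqxx.
Qed.
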